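(* Let $(X,T)$ be a dynamical system with the shadowing property such that $h_{\mathrm{top}}(T,X)<\infty$, and let $m$ be a finite Borel measure on $X$. Then for every $\Phi\in\mathcal{C}(X,\mathbb{R})$, every $c\in\mathbb{R}$ and every $\xi\in\mathcal{V}^-$ we have $$\underline{R}(\Phi,(c,\infty))\geq\sup\Big\{h_\nu(T)-\int\xi\,d\nu:\ \nu\in\mathcal{M}_T(X),\ \int\Phi\,d\nu>c,\ \nu\text{ is supported on some chain recurrent class }Y\subseteq X\Big\}.$$
   Context: A dynamical system $(X,T)$ is a compact metric space $(X,d)$ together with a continuous map $T:X\to X$. $\mathcal{C}(X,\mathbb{R})$ is the set of continuous functions $X\to\mathbb{R}$; $\mathcal{M}_T(X)$ is the set of $T$-invariant Borel probability measures on $X$; $h_\nu(T)$ is the Kolmogorov–Sinai metric entropy of $T$ with respect to $\nu$; $h_{\mathrm{top}}(T,X)$ is the topological entropy of $T$. For $\delta>0$, a sequence $\{x_n\}_{n\ge 0}\subseteq X$ is a $\delta$-pseudo-orbit if $d(Tx_n,x_{n+1})<\delta$ for all $n\geq 0$; a finite one $\{x_i\}_{i=0}^k$, with $k\ge1$, is a $\delta$-chain from $x_0$ to $x_k$. $(X,T)$ has the shadowing property if for every $\varepsilon>0$ there is $\delta>0$ such that for every $\delta$-pseudo-orbit $\{x_n\}_{n\ge 0}$ there is $y\in X$ with $d(T^ny,x_n)<\varepsilon$ for all $n\geq 0$. Points $x,y\in X$ are chain related if for every $\varepsilon>0$ there are an $\varepsilon$-chain from $x$ to $y$ and an $\varepsilon$-chain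 from $y$ to $x$. A point is chain recurrent if it is chain related to itself. Chain relatedness is an equivalence relation on the set $CR(X)$ of chain recurrent points, and its equivalence classes are the chain recurrent classes; each is closed and satisfies $T(Y)\subseteq Y$. A measure $\nu$ is supported on $Y$ if $\mathrm{supp}(\nu)\subseteq Y$. The measure $m$ is a reference measure; it need not be $T$-invariant. Let $B_n(x,\varepsilon)=\{y\in X:d(T^jx,T^jy)<\varepsilon\text{ for all }0\le j\le n-1\}$ (so $B_0(x,\varepsilon)=X$). $\mathcal{V}^-$ is the set of all $\xi\in\mathcal{C}(X,\mathbb{R})$ for which there exist arbitrarily small $\varepsilon>0$ and constants $C=C(\varepsilon)>0$ such that for all $x\in X$ and all $n\geq0$, $$m(B_n(x,\varepsilon))\geq Ce^{-\sum_{i=0}^{n-1}\xi(T^ix)}.$$ For $\Phi\in\mathcal{C}(X,\mathbb{R})$ and $E\subseteq\mathbb{R}$, $$\underline{R}(\Phi,E)=\liminf_{n\to\infty}\frac1n\log m\Big(\Big\{x\in X:\frac1n\sum_{i=0}^{n-1}\Phi(T^ix)\in E\Big\}\Big),$$ with $\log0=-\infty$ and $\sup\emptyset=-\infty$. *)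

(* Defs.v *)
From HB Require Import structures.
From mathcomp Require Import all_boot all_order all_algebra finmap.
From mathcomp Require Import all_classical all_reals all_analysis.

Set Implicit Arguments.
Unset Strict Implicit.
Unset Printing Implicit Defensive.

Import Order.TTheory GRing.Theory Num.Theory.
Import numFieldNormedType.Exports.

Local Open Scope classical_set_scope.
Local Open Scope ring_scope.

(* Measurable types of the library are pointed, so the metric spaces carrying
   Borel measures are taken to be pointed, i.e. nonempty. *)
#[short(type="pmetricType")]
HB.structure Definition PMetric (K : numDomainType) :=
  { M of Metric K M & Pointed M }.

Notation borel X := (g_sigma_algebraType (@open X)).

Section Dynamics.
Context {R : realType} {X : pmetricType R}.
Implicit Types (T : X -> X) (x y : X) (Y : set X) (Phi xi : X -> R).

Definition birkhoff_sum T Phi n x : R := \sum_(i < n) Phi (iter i T x).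

Definition bowen_ball T n x (eps : R) : set X :=
  [set y | forall j, (j < n)%N -> mdist (iter j T x) (iter j T y) < eps].

Definition pseudo_orbit T (delta : R) (u : nat -> X) :=
  forall n, mdist (T (u n)) (u n.+1) < delta.

Definition shadowing_property T :=
  forall eps : R, 0 < eps -> exists2 delta : R, 0 < delta &
    forall u : nat -> X, pseudo_orbit T delta u ->
      exists y, forall n, mdist (iter n T y) (u n) < eps.

(* Only the terms u 0, ..., u k of the sequence matter. *)
Definition chain T (delta : R) x y :=
  exists (k : nat) (u : nat -> X), [/\ (1 <= k)%N, u 0%N = x, u k = y &
    forall i, (i < k)%N -> mdist (T (u i)) (u i.+1) < delta].

Definition chain_related T x y :=
  forall eps : R, 0 < eps -> chain T eps x y /\ chain T eps y x.

Definition chain_recurrent T : set X := [set x | chain_related T x x].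

Definition chain_recurrent_class T Y :=
  exists2 x, chain_recurrent T x &
    Y = [set y | chain_recurrent T y /\ chain_related T x y].

Local Open Scope ereal_scope.

Definition separated T n (eps : R) (F : {fset X}) :=
  forall x y, x \in F -> y \in F -> x <> y -> ~ bowen_ball T n x eps y.

Definition max_separated T n (eps : R) : \bar R :=
  ereal_sup [set (#|` F|%:R)%:E | F in [set F | separated T n eps F]].

(* Bowen's definition; the limit as eps tends to 0 is a supremum because
   max_separated is nonincreasing in eps. *)
Definition topological_entropy T : \bar R :=
  ereal_sup [set limn_esup (fun n => (n%:R^-1)%:E * lne (max_separated T n eps))
            | eps in [set eps : R | (0 < eps)%R]].

Definition invariant_measures T : set (probability (borel X) R) :=
  [set nu | forall A : set (borel X), measurable A -> nu (T @^-1` A) = nu A].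

(* Empty cells are allowed; they do not affect the entropy. *)
Definition measurable_partition k (P : 'I_k -> set (borel X)) :=
  [/\ forall i, measurable (P i), trivIset [set: 'I_k] P &
      \bigcup_i P i = [set: X]].

(* The cells of the join of T^-i P for 0 <= i < n, indexed by itineraries. *)
Definition join_cell T k (P : 'I_k -> set (borel X)) n
    (w : {ffun 'I_n -> 'I_k}) : set (borel X) :=
  [set x | forall i : 'I_n, P (w i) (iter i T x)].

(* ln 0 = 0 in the library, so null cells contribute 0. *)
Definition join_entropy T (nu : probability (borel X) R)
    k (P : 'I_k -> set (borel X)) n : R :=
  (- \sum_(w : {ffun 'I_n -> 'I_k})
       let p := fine (nu (join_cell T P w)) in p * ln p)%R.

(* The limit exists by subadditivity when nu is T-invariant. *)
Definition partition_entropy T (nu : probability (borel X) R)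
    k (P : 'I_k -> set (borel X)) : R :=
  limn (fun n => (n%:R^-1 * join_entropy T nu P n)%R).

Definition metric_entropy T (nu : probability (borel X) R) : \bar R :=
  ereal_sup [set h | exists k (P : 'I_k -> set (borel X)),
    measurable_partition P /\ h = (partition_entropy T nu P)%:E].

Definition measure_support (nu : probability (borel X) R) : set X :=
  [set x | forall U : set X, open U -> U x -> 0 < nu U].

Definition supported_on (nu : probability (borel X) R) Y :=
  measure_support nu `<=` Y.

Definition Vminus T (m : {finite_measure set (borel X) -> \bar R}) :
    set (X -> R) :=
  [set xi | continuous xi /\
    forall eps0 : R, (0 < eps0)%R -> exists eps : R, (0 < eps < eps0)%R /\
      exists2 C : R, (0 < C)%R & forall x n,
        (C * expR (- birkhoff_sum T xi n x))%:E <= m (bowen_ball T n x eps)].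

Definition lower_rate T (m : {finite_measure set (borel X) -> \bar R})
    Phi (E : set R) : \bar R :=
  limn_einf (fun n => (n%:R^-1)%:E *
    lne (m [set x | E (n%:R^-1 * birkhoff_sum T Phi n x)%R])).

End Dynamics.

(* Main.v *)
Require Import Defs.
From mathcomp Require Import all_boot all_order all_algebra finmap.
From mathcomp Require Import all_classical all_reals all_analysis.
From mathcomp Require Import lra ring.
Import Order.TTheory GRing.Theory Num.Theory.
Import numFieldNormedType.Exports.

Local Open Scope classical_set_scope.
Local Open Scope ring_scope.

Set Implicit Arguments.
Unset Strict Implicit.
Unset Printing Implicit Defensive.

(** The idea is to compare orbits of [T] with sequences of orbit segments chosen
    independently according to the invariant measure [nu], so that neither the
    ergodic theorem nor an ergodic decomposition enters.

    Fix a finite partition [P] with [nu]-entropy [h] and a long block length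
    [n], so that the [n]-step itineraries have Shannon entropy at least about
    [n * h].  Choose a representative orbit segment of length [n] for each
    itinerary of positive measure, starting in the support of [nu], and draw
    [k] itineraries independently.  The support lies in one chain recurrent
    class, so segments can be joined by chains whose length is bounded
    independently of [n] ([uniform_chain_length]); the pseudo-orbit obtained is
    shadowed by a true orbit.  By invariance the expected Birkhoff sum of [Phi]
    over a segment is [n] times its integral ([block_mean]), hence by
    Chebyshev's inequality most choices lead to an average larger than [c] on
    the whole shadowing orbit ([birkhoff_sum_traces]).  The same inequality
    applied to minus the logarithm of the probability of an itinerary, whose
    mean is the Shannon entropy, says that a typical choice has probability at
    most about [exp (- k * n * h)]: this is where the entropy enters
    ([iid_weight]).  Since the Bowen ball of the shadowing
    point has [m]-measure at least [C * exp (- (Birkhoff sum of xi))], adding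
    up the masses gives a total mass of at least about
    [exp (k * n * (h - integral of xi))].

    The balls may overlap.  Different itineraries need not be separated, as
    points near the boundary of the partition can be arbitrarily close; so
    every cell is given a closed subset of nearly full measure, and a flag
    records whether a point lies in it.  Distinct closed sets are a positive
    distance apart, so at each time an orbit is close to at most one of them.
    Each symbol outside the closed sets is given a small weight [b]: it occurs so rarely that the loss of total mass
    is negligible ([flagged_code]), while the total weight of the itineraries
    whose balls contain a given point becomes at most [(1 + #|J| * b) ^ n] per
    block ([compatible_block_weight]), times the number of possible gap lengths
    ([trace_multiplicity]).  Integrating this multiplicity bound
    ([weighted_cover]) turns the sum of the masses of the balls into a lower
    bound for the mass of their union ([exponential_lower_bound]). *)

(** * Independent blocks *)

Section IndependentBlocks.
Context {R : realType} {W : finType}.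
Implicit Types (p f g a : W -> R) (s : seq W).

Definition iid p s : R := \prod_(w <- s) p w.

Lemma iid_ge0 p s : (forall w, 0 <= p w) -> 0 <= iid p s.
Proof. by move=> p0; apply: prodr_ge0. Qed.

Lemma sum_tuple_cons k (F : k.+1.-tuple W -> R) :
  \sum_s F s = \sum_w \sum_(s : k.-tuple W) F [tuple of w :: s].
Proof.
rewrite pair_big (reindex (fun ws : W * k.-tuple W => [tuple of ws.1 :: ws.2])) //=.
exists (fun s : k.+1.-tuple W => (thead s, [tuple of behead s])).
  by move=> [w s] _; congr (_, _); apply/val_inj.
by move=> s _; rewrite [RHS]tuple_eta; apply/val_inj.
Qed.

Lemma sum_tuple0 (F : 0.-tuple W -> R) : \sum_s F s = F [tuple].
Proof.
rewrite (bigD1 [tuple]) //= big1 ?addr0 // => s /eqP[]; exact: tuple0.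
Qed.

Lemma sum_iid p k : \sum_w p w = 1 -> \sum_(s : k.-tuple W) iid p s = 1.
Proof.
move=> p1; elim: k => [|k IH]; first by rewrite sum_tuple0 /iid big_nil.
rewrite sum_tuple_cons -p1; apply: eq_bigr => w _.
under eq_bigr do rewrite /iid big_cons.
by rewrite -mulr_sumr IH mulr1.
Qed.

Lemma iid_mean p f k : \sum_w p w = 1 -> \sum_w p w * f w = 0 ->
  \sum_(s : k.-tuple W) iid p s * \sum_(w <- s) f w = 0.
Proof.
move=> p1 f0; elim: k => [|k IH]; first by rewrite sum_tuple0 big_nil mulr0.
rewrite sum_tuple_cons -[RHS]f0; apply: eq_bigr => w _.
under eq_bigr do rewrite /iid !big_cons -mulrA mulrDr.
rewrite -mulr_sumr big_split /= IH addr0 -mulr_suml.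
by rewrite (sum_iid k p1) mul1r.
Qed.

(** The cross terms vanish, so the variances of independent blocks add up. *)
Lemma iid_variance p f k : \sum_w p w = 1 -> \sum_w p w * f w = 0 ->
  \sum_(s : k.-tuple W) iid p s * (\sum_(w <- s) f w) ^+ 2 =
  k%:R * \sum_w p w * f w ^+ 2.
Proof.
move=> p1 f0; elim: k => [|k IH].
  by rewrite sum_tuple0 big_nil expr0n /= mulr0 mul0r.
rewrite sum_tuple_cons.
have step w : \sum_(s : k.-tuple W)
    iid p [tuple of w :: s] * (\sum_(w <- [tuple of w :: s]) f w) ^+ 2 =
  p w * f w ^+ 2 + p w * (k%:R * \sum_w p w * f w ^+ 2).
  rewrite -IH.
  transitivity (\sum_(s : k.-tuple W) (p w * f w ^+ 2 * iid p s +
     (2 * p w * f w) * (iid p s * \sum_(w <- s) f w) +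
     p w * (iid p s * (\sum_(w <- s) f w) ^+ 2))).
    by apply: eq_bigr => s _; rewrite /iid !big_cons; ring.
  rewrite !big_split /= -!mulr_sumr (sum_iid k p1) (iid_mean k p1 f0).
  by ring.
under eq_bigr do rewrite step.
rewrite big_split /= -mulr_suml p1 mul1r -natr1; ring.
Qed.

(** Chebyshev's inequality, from the variance of a sum of independent terms. *)
Lemma iid_deviation p f k (mean tau : R) : (forall w, 0 <= p w) ->
    \sum_w p w = 1 -> 0 < tau -> \sum_w p w * f w = mean ->
  k%:R * tau ^+ 2 *
    \sum_(s : k.-tuple W | \sum_(w <- s) f w < k%:R * (mean - tau)) iid p s
  <= \sum_w p w * (f w - mean) ^+ 2.
Proof.
move=> p0 p1 tau0 fmean.
case: k => [|k].
  by rewrite !mul0r sumr_ge0 // => w _; rewrite mulr_ge0 ?sqr_ge0.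
have k0 : 0 < k.+1%:R :> R by rewrite ltr0n.
have c0 : \sum_w p w * (f w - mean) = 0.
  by under eq_bigr do rewrite mulrBr; rewrite sumrB -mulr_suml p1 mul1r fmean subrr.
rewrite -(ler_pM2l k0) -(iid_variance _ p1 c0) mulrA mulr_sumr.
rewrite [leRHS](bigID (fun s : k.+1.-tuple W =>
   \sum_(w <- s) f w < k.+1%:R * (mean - tau))) /=.
rewrite -[leLHS]addr0; apply: lerD; last first.
  by apply: sumr_ge0 => s _; rewrite mulr_ge0 ?iid_ge0 ?sqr_ge0.
apply: ler_sum => s dev; rewrite mulrC ler_wpM2l ?iid_ge0 //.
have -> : \sum_(w <- s) (f w - mean) = \sum_(w <- s) f w - k.+1%:R * mean.
  by rewrite sumrB big_const_seq count_predT size_tuple iter_addr_0 mulr_natl.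
have kt : 0 < k.+1%:R * tau by rewrite mulr_gt0.
have -> : k.+1%:R * (k.+1%:R * tau ^+ 2) = (k.+1%:R * tau) ^+ 2 by ring.
have far : k.+1%:R * tau <= - (\sum_(w <- s) f w - k.+1%:R * mean) by lra.
by rewrite -[leRHS]sqrrN lerXn2r ?nnegrE ?(le_trans (ltW kt) far) ?(ltW kt).
Qed.

(** Both sums deviate with probability O(1/k), so together they are typical
    with probability at least one half. *)
Lemma iid_typical p f g (tau : R) : (forall w, 0 <= p w) ->
    \sum_w p w = 1 -> 0 < tau -> exists K, forall k, (K <= k)%N ->
  2^-1 <= \sum_(s : k.-tuple W |
    (k%:R * (\sum_w p w * f w - tau) <= \sum_(w <- s) f w) &&
    (k%:R * (\sum_w p w * g w - tau) <= \sum_(w <- s) g w)) iid p s.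
Proof.
move=> p0 p1 tau0.
set mf := \sum_w p w * f w; set mg := \sum_w p w * g w.
set V := \sum_w p w * (f w - mf) ^+ 2 + \sum_w p w * (g w - mg) ^+ 2.
have V0 : 0 <= V.
  by apply: addr_ge0; apply: sumr_ge0 => w _; rewrite mulr_ge0 ?sqr_ge0.
have t20 : 0 < tau ^+ 2 by rewrite exprn_gt0.
exists (Num.truncn (2 * V / tau ^+ 2)).+1 => k Kk.
have kV : 2 * V <= k%:R * tau ^+ 2.
  rewrite -ler_pdivrMr //; apply: le_trans (ltW (truncnS_gt _)) _.
  by rewrite ler_nat.
have k0 : 0 < k%:R :> R by rewrite ltr0n (leq_trans _ Kk).
have kt0 : 0 < k%:R * tau ^+ 2 by rewrite mulr_gt0.
have df := iid_deviation k p0 p1 tau0 (erefl mf).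
have dg := iid_deviation k p0 p1 tau0 (erefl mg).
set good := BIG_P.
have := sum_iid k p1; rewrite (bigID good) /= => tot.
suff bad : \sum_(s : k.-tuple W | ~~ good s) iid p s <= 2^-1.
  move: tot; set A := \sum_(_ | good _) _; set B := \sum_(_ | _) _ in bad *.
  lra.
have badU : \sum_(s : k.-tuple W | ~~ good s) iid p s <=
   \sum_(s : k.-tuple W | \sum_(w <- s) f w < k%:R * (mf - tau)) iid p s +
   \sum_(s : k.-tuple W | \sum_(w <- s) g w < k%:R * (mg - tau)) iid p s.
  rewrite big_mkcond [X in _ <= X + _]big_mkcond [X in _ <= _ + X]big_mkcond /=.
  rewrite -big_split /=; apply: ler_sum => s _; rewrite /good negb_and -!ltNge.
  by have := iid_ge0 s p0; case: (_ < _); case: (_ < _) => /= ?; lra.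
apply: le_trans badU _; rewrite -(ler_pM2l kt0) mulrDr.
apply: le_trans (lerD df dg) _; rewrite -/V; lra.
Qed.

(** The asymptotic equipartition argument.  On sequences of blocks where the
    sum of [lam] is typical, the product of the weights [a] dominates the
    probability by an explicit exponential, so the total weight of the
    typical sequences is at least half of that exponential. *)
Lemma iid_weight p a lam phi (tau : R) : (forall w, 0 <= p w) ->
    \sum_w p w = 1 -> 0 < tau -> (forall w, p w * expR (lam w) <= a w) ->
  exists K, forall k, (K <= k)%N ->
  2^-1 * expR (k%:R * (\sum_w p w * lam w - tau)) <=
  \sum_(s : k.-tuple W | k%:R * (\sum_w p w * phi w - tau) <= \sum_(w <- s) phi w)
     \prod_(w <- s) a w.
Proof.
move=> p0 p1 tau0 pa.
have a0 w : 0 <= a w by apply: le_trans (pa w); rewrite mulr_ge0 ?expR_ge0.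
have [K HK] := iid_typical phi lam p0 p1 tau0.
exists K => k /HK half.
apply: le_trans (ler_wpM2r (expR_ge0 _) half) _.
rewrite mulr_suml.
rewrite [leRHS](bigID (fun s : k.-tuple W =>
   k%:R * (\sum_w p w * lam w - tau) <= \sum_(w <- s) lam w)) /=.
rewrite -[leLHS]addr0 lerD //; last first.
  by apply: sumr_ge0 => s _; apply: prodr_ge0.
apply: ler_sum => s /andP[_ slam].
apply: le_trans (_ : iid p s * expR (\sum_(w <- s) lam w) <= _).
  by rewrite ler_wpM2l ?iid_ge0 // ler_expR.
rewrite expR_sum /iid -big_split /=; apply: ler_prod => w _.
by rewrite pa andbT mulr_ge0 ?expR_ge0.
Qed.

End IndependentBlocks.

(** * Compact metric spaces *)

Section CompactMetric.
Context {R : realType} {X : pmetricType R}.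
Implicit Types (x y : X) (A : set X).

Lemma open_mdist_ball x (e : R) : open [set y : X | mdist x y < e].
Proof.
rewrite openE => y /= xy; apply/metricType_numDomainType.nbhs_mdistP.
exists (e - mdist x y) => /=; first by rewrite subr_gt0.
by move=> z /= yz; apply: le_lt_trans (metric_triangle x y z) _; lra.
Qed.

Lemma compact_uniform_continuity (M : pseudoMetricType R) (f : X -> M) :
  compact [set: X] -> continuous f -> forall e : R, 0 < e ->
  exists2 r : R, 0 < r & forall x y, mdist x y < r -> ball (f x) e (f y).
Proof.
move=> /compact_near_coveringP cX cf e e0.
have e20 : 0 < e / 2 by lra.
have : \forall r \near 0^'+, [set: X] `<=`
    [set x | forall y, mdist x y < r -> ball (f x) e (f y)].
  apply: cX => x _.
  have : \forall y \near x, ball (f x) (e / 2) (f y) by exact: (cvg_ball (cf x)).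
  move=> /metricType_numDomainType.nbhs_mdistP[/= d d0 Hd].
  exists ([set x' | mdist x x' < d / 2], [set r : R | 0 < r < d / 2]) => /=.
    split; first by apply/metricType_numDomainType.nbhs_mdistP; exists (d / 2) => //=; lra.
    by near=> r; apply/andP; split; near: r;
      [exact: nbhs_right_gt | apply: nbhs_right_lt; lra].
  move=> [x' r] [/= xx' /andP[r0 rd]] y x'y.
  have fx' : ball (f x) (e / 2) (f x') by apply: Hd => /=; lra.
  have fy : ball (f x) (e / 2) (f y).
    by apply: Hd => /=; have := metric_triangle x x' y; lra.
  by rewrite [e]splitr; apply: ball_triangle (ball_sym fx') fy.
move=> near0; have [r [r0 Hr]] : exists r : R, 0 < r /\ [set: X] `<=`
    [set x | forall y, mdist x y < r -> ball (f x) e (f y)].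
  near (0 : R)^'+ => r; exists r; split; first by near: r; exact: nbhs_right_gt.
  by near: r.
by exists r => // x y; apply: Hr.
Unshelve. all: by end_near. Qed.

Lemma compact_continuous_bounded (f : X -> R) :
  compact [set: X] -> continuous f -> exists B, forall x, `|f x| <= B.
Proof.
move=> cX cf; have cnf : {within [set: X], continuous (fun x => `|f x|)}.
  apply: continuous_subspaceT => x.
  by apply: continuous_comp; [exact: cf|exact: norm_continuous].
have [x0 _ Hx0] := @compact_EVT_max X R _ setT (ex_intro _ point I) cX cnf.
by exists `|f x0| => x; apply: Hx0; rewrite inE.
Qed.

Lemma compact_net : compact [set: X] -> forall r : R, 0 < r ->
  exists s : seq X, forall x, exists2 c, c \in s & mdist c x < r.
Proof.
rewrite compact_cover => cX r r0.
have [|x _|D _ DX] := cX X setT (fun c => [set y | mdist c y < r]).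
- by move=> c _; exact: open_mdist_ball.
- by exists x => //=; rewrite mdistxx.
exists (enum_fset D) => x; have [c Dc cx] := DX x I.
by exists c.
Qed.

Lemma seq_uniform_bound (I : eqType) (s : seq I) (P : I -> nat -> Prop) :
    (forall c N N', (N <= N')%N -> P c N -> P c N') ->
    (forall c, c \in s -> exists N, P c N) ->
  exists N, forall c, c \in s -> P c N.
Proof.
move=> mono; elim: s => [|c s IH] Hs; first by exists 0%N.
have [N HN] := Hs c (mem_head _ _).
have [|N' HN'] := IH; first by move=> d ds; apply: Hs; rewrite inE ds orbT.
exists (maxn N N') => d; rewrite inE => /predU1P[->|/HN'].
  exact: mono (leq_maxl _ _) HN.
exact: mono (leq_maxr _ _).
Qed.

End CompactMetric.

(** * Gluing orbit segments *)

Section Gluing.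
Context {R : realType} {X : pmetricType R}.
Variable T : X -> X.
Implicit Types (x y z : X) (s : seq X) (u v : nat -> X) (d delta : R).

Definition chain_upto delta N x y :=
  exists g u, [/\ (0 < g <= N)%N, u 0%N = x, u g = y &
    forall i, (i < g)%N -> mdist (T (u i)) (u i.+1) < delta].

(** A finite net of base points turns the individual chain lengths into a
    common bound: a chain between two base points becomes a slightly coarser
    chain between any points near them once its ends are replaced. *)
Lemma uniform_chain_length (Y : set X) delta :
    compact [set: X] -> continuous T -> 0 < delta ->
    (forall x y, Y x -> Y y -> forall e : R, 0 < e -> chain T e x y) ->
  exists N, forall x y, Y x -> Y y -> chain_upto delta N x y.
Proof.
move=> cX cT delta0 YY.
have d30 : 0 < delta / 3 by lra.
have [r r0 Tr] := compact_uniform_continuity cX cT d30.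
have {}Tr x y : mdist x y < r -> mdist (T x) (T y) < delta / 3.
  by move=> /Tr; rewrite ballEmdist.
set r' := Num.min (r / 2) (delta / 6).
have r'0 : 0 < r' by rewrite lt_min; lra.
have rr : r' <= r / 2 by rewrite ge_min lexx.
have rd : r' <= delta / 6 by rewrite ge_min lexx orbT.
have [s net] := compact_net cX r'0.
pose P (cc : X * X) N := forall x y, Y x -> Y y ->
  mdist cc.1 x < r' -> mdist cc.2 y < r' -> chain_upto delta N x y.
have [||N HN] := @seq_uniform_bound _ [seq (c, c') | c <- s, c' <- s] P.
- move=> cc N N' NN' HP x y Yx Yy cx cy.
  have [g [u [/andP[g0 gN] u0 ug ch]]] := HP x y Yx Yy cx cy.
  by exists g, u; rewrite g0 (leq_trans gN NN').
- move=> [c c'] _; rewrite /P /=.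
  have [[[a b] [Ya Yb ca cb]]|none] := pselect (exists ab : X * X,
    [/\ Y ab.1, Y ab.2, mdist c ab.1 < r' & mdist c' ab.2 < r']); last first.
    by exists 0%N => x y Yx Yy cx cy; case: none; exists (x, y).
  rewrite /= in Ya Yb ca cb.
  have [g [u [g0 u0 ug ch]]] := YY a b Ya Yb _ d30.
  exists g => x y Yx Yy cx cy.
  have ax : mdist x a < r.
    by have := metric_triangle x c a; rewrite (metric_sym x c); lra.
  have by' : mdist b y < delta / 3.
    by have := metric_triangle b c' y; rewrite (metric_sym b c'); lra.
  exists g, (fun i => if i == 0%N then x else if i == g then y else u i).
  split; rewrite ?g0 ?leqnn ?eqxx //; first by case: g g0 {u0 ug ch}.
  move=> i ig; rewrite /= (ltn_eqF ig).
  have start : mdist (T (if i == 0%N then x else u i)) (u i.+1) < 2 * (delta / 3).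
    have := ch i ig; case: (i =P 0%N) => [->|_]; last by lra.
    rewrite u0 => aE; have := Tr _ _ ax.
    by have := metric_triangle (T x) (T a) (u 1%N); lra.
  case: (i.+1 =P g) => [gE|_]; last by lra.
  by move: start; rewrite gE ug => st; have := metric_triangle
    (T (if i == 0%N then x else u i)) b y; lra.
exists N => x y Yx Yy.
have [c cs cx] := net x; have [c' cs' cy] := net y.
by apply: (HN (c, c')) => //; apply: allpairs_f.
Qed.

(** Recursive on the list of segments, so that gluing, shadowing and decoding
    can all peel off one segment at a time. *)
Fixpoint concatenates n N s u : Prop :=
  if s is x :: s' then
    (forall i, (i < n)%N -> u i = iter i T x) /\
    exists2 g, (g <= N)%N & concatenates n N s' (fun i => u (n + g + i)%N)
  else True.

(** The gaps are existentially quantified because their lengths depend on the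
    pairs of consecutive segments and cannot be read off from the point. *)
Fixpoint traces n N d s z : Prop :=
  if s is x :: s' then
    (forall i, (i < n)%N -> mdist (iter i T x) (iter i T z) < d) /\
    exists2 g, (g <= N)%N & traces n N d s' (iter (n + g) T z)
  else True.

Lemma concatenates_eq n N s u v :
  (forall i, u i = v i) -> concatenates n N s u -> concatenates n N s v.
Proof. by move=> /funext ->. Qed.

(** Built from the last segment backwards: a chain from the end of a segment
    arrives exactly at the start of the pseudo-orbit already constructed. *)
Lemma pseudo_orbit_concatenation (Y : set X) n N delta : (0 < n)%N ->
    0 < delta ->
    (forall x y, Y x -> Y y -> chain_upto delta N (iter n T x) y) ->
  forall s x, Y x -> {in s, forall y, Y y} ->
  exists u, [/\ pseudo_orbit T delta u, u 0%N = x & concatenates n N (x :: s) u].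
Proof.
move=> n0 delta0 YY; elim=> [|y s IH] x Yx Ys.
  exists (fun i => iter i T x); split => //=.
    by move=> i; rewrite -iterS mdistxx.
  by split => //; exists 0%N.
have Yy : Y y by apply: Ys; rewrite mem_head.
have [|v [vps v0 vcon]] := IH y Yy.
  by move=> z zs; apply: Ys; rewrite inE zs orbT.
have [g [c [/andP[g0 gN] c0 cg cch]]] := YY x y Yx Yy.
pose u i := if (i < n)%N then iter i T x else
  if (i < n + g)%N then c (i - n)%N else v (i - (n + g))%N.
have u1 i : (i <= n)%N -> u i = iter i T x.
  rewrite leq_eqVlt /u => /predU1P[->|->] //.
  by rewrite ltnn -[ltnLHS]addn0 ltn_add2l g0 subnn c0.
have u2 i : (i <= g)%N -> u (n + i)%N = c i.
  rewrite /u ltnNge leq_addr /= ltn_add2l leq_eqVlt => /predU1P[->|->].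
    by rewrite ltnn subnn v0 cg.
  by rewrite addKn.
have u3 i : u (n + g + i)%N = v i.
  rewrite /u ltnNge -addnA leq_addr /= addnA ltnNge leq_addr /=.
  by rewrite addKn.
exists u; split.
- move=> i; have [ltin|leni] := ltnP i n.
    by rewrite !u1 ?(ltnW ltin) // -iterS mdistxx.
  have [ltig|legi] := ltnP i (n + g).
    move: ltig; rewrite -(subnKC leni) ltn_add2l => ltig.
    by rewrite -addnS !u2 ?(ltnW ltig) //; exact: cch.
  by rewrite -(subnKC legi) -addnS !u3; exact: vps.
- by rewrite u1.
- split; first by move=> i /ltnW /u1.
  by exists g => //; apply: concatenates_eq vcon => i; rewrite u3.
Qed.

Lemma shadow_traces n N (e : R) s : forall u z, concatenates n N s u ->
  (forall i, mdist (iter i T z) (u i) < e) -> traces n N e s z.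
Proof.
elim: s => //= x s IH u z [ux [g gN con]] sh; split.
  by move=> i lin; rewrite metric_sym -ux.
exists g => //; apply: IH con _ => i.
by rewrite -iterD addnC.
Qed.

Lemma traces_bowen n N d (e : R) s l : forall y z, traces n N d s y ->
  (size s * (n + N) <= l)%N -> bowen_ball T l y e z -> traces n N (d + e) s z.
Proof.
elim: s l => //= x s IH l y z [near [g gN tr]]; rewrite mulSn => sl yz; split.
  move=> i lin; have il : (i < l)%N.
    by apply: leq_trans lin (leq_trans _ sl); rewrite -addnA leq_addr.
  have := near i lin; have := yz i il.
  by have := metric_triangle (iter i T x) (iter i T y) (iter i T z); lra.
exists g => //; apply: (IH (l - (n + g))%N) tr _ _.
  have ngl : (n + g <= l)%N.
    by apply: leq_trans sl; rewrite (leq_trans _ (leq_addr _ _)) ?leq_add2l.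
  by rewrite leq_subRL // (leq_trans _ sl) // leq_add2r leq_add2l.
move=> j; rewrite ltn_subRL => jl; rewrite -!iterD ![(j + _)%N]addnC.
exact: yz.
Qed.

Lemma birkhoff_sumD (F : X -> R) m n x :
  birkhoff_sum T F (m + n) x =
  birkhoff_sum T F m x + birkhoff_sum T F n (iter m T x).
Proof.
rewrite /birkhoff_sum big_split_ord /=; congr (_ + _).
by apply: eq_bigr => i _; rewrite -iterD addnC.
Qed.

Lemma birkhoff_sum_bound (F : X -> R) (B : R) n x :
  (forall y, `|F y| <= B) -> `|birkhoff_sum T F n x| <= n%:R * B.
Proof.
move=> FB; apply: le_trans (ler_norm_sum _ _ _) _.
rewrite mulr_natl -[X in _ *+ X](card_ord n) -sumr_const.
exact: ler_sum.
Qed.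

(** Outside the shadowed segments, only the total length of the gaps and of
    the unconstrained final piece matters. *)
Lemma birkhoff_sum_traces (F : X -> R) (B eta d : R) n N s l :
    (forall y, `|F y| <= B) ->
    (forall x y, mdist x y < d -> `|F x - F y| <= eta) ->
  forall z, traces n N d s z -> (size s * (n + N) <= l)%N ->
  `|birkhoff_sum T F l z - \sum_(x <- s) birkhoff_sum T F n x|
  <= (size s * n)%:R * eta + (l - size s * n)%:R * B.
Proof.
move=> FB osc; elim: s l => [|x s IH] l z /=.
  by move=> _ _; rewrite big_nil subr0 !mul0n mul0r add0r subn0;
    exact: birkhoff_sum_bound.
move=> [near [g gN tr]]; rewrite !mulSn => sl.
have ngl : (n + g <= l)%N.
  by apply: leq_trans sl; rewrite (leq_trans _ (leq_addr _ _)) ?leq_add2l.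
have rest : (size s * (n + N) <= l - (n + g))%N.
  by rewrite leq_subRL // (leq_trans _ sl) // leq_add2r leq_add2l.
have {}IH := IH _ _ tr rest.
rewrite -(subnKC ngl) birkhoff_sumD birkhoff_sumD big_cons.
set l' := (l - (n + g))%N in rest IH *.
have first : `|birkhoff_sum T F n z - birkhoff_sum T F n x| <= n%:R * eta.
  rewrite /birkhoff_sum -sumrB; apply: le_trans (ler_norm_sum _ _ _) _.
  rewrite mulr_natl -[X in _ *+ X](card_ord n) -sumr_const.
  by apply: ler_sum => i _; rewrite distrC; apply/osc/near.
have gap := birkhoff_sum_bound g (iter n T z) FB.
have slen : (size s * n <= l')%N.
  by apply: leq_trans rest; rewrite leq_mul2l leq_addr orbT.
have -> : (n + g + l' - (n + size s * n) = g + (l' - size s * n))%N.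
  by rewrite -addnA subnDl addnBA.
rewrite !natrD.
set a := birkhoff_sum T F n z in first *.
set a' := birkhoff_sum T F n x in first *.
set b := birkhoff_sum T F g _ in gap *.
set c := birkhoff_sum T F l' _ in IH *.
set t := \sum_(_ <- _) _ in IH *.
have -> : a + b + c - (a' + t) = (a - a') + b + (c - t) by ring.
apply: le_trans (ler_normD _ _) _.
by have := ler_normD (a - a') b; lra.
Qed.

(** Decoding a traced sequence one block at a time costs a factor [N.+1] for
    the unknown gap and a factor [M] for the blocks compatible with the first
    segment of the orbit. *)
Lemma trace_multiplicity (W : finType) (x : W -> X) (a : W -> R) (M d : R) n N :
    (forall w, 0 <= a w) ->
    (forall z, \sum_(w | `[< forall i, (i < n)%N ->
        mdist (iter i T (x w)) (iter i T z) < d >]) a w <= M) ->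
  forall k z, \sum_(s : k.-tuple W | `[< traces n N d (map x s) z >])
    \prod_(w <- s) a w <= (N.+1%:R * M) ^+ k.
Proof.
move=> a0 aM; have M0 : 0 <= M by apply: le_trans (aM point); exact: sumr_ge0.
have pa0 (s : seq W) : 0 <= \prod_(w <- s) a w by apply: prodr_ge0.
elim=> [|k IH] z; rewrite big_mkcond /=.
  by rewrite sum_tuple0 big_nil expr0; case: ifP.
rewrite sum_tuple_cons.
apply: le_trans (_ : \sum_w (if `[< forall i, (i < n)%N ->
    mdist (iter i T (x w)) (iter i T z) < d >] then a w else 0) *
    (N.+1%:R * (N.+1%:R * M) ^+ k) <= _); last first.
  rewrite -mulr_suml -big_mkcond exprS [leRHS](_ : _ = M * (N.+1%:R * (N.+1%:R * M) ^+ k)).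
    by rewrite ler_wpM2r // mulr_ge0 ?exprn_ge0 ?mulr_ge0.
  by rewrite mulrA [M * _]mulrC.
apply: ler_sum => w _; case: asboolP => near; last first.
  rewrite mul0r big1 // => s _; case: asboolP => // -[//].
apply: le_trans (_ : \sum_(s : k.-tuple W) \sum_(g : 'I_N.+1)
   (if `[< traces n N d (map x s) (iter (n + g) T z) >]
    then a w * \prod_(v <- s) a v else 0) <= _).
  apply: ler_sum => s _; case: asboolP => [[_ [g gN tr]]|_]; last first.
    by apply: sumr_ge0 => g _; case: ifP => // _; rewrite mulr_ge0.
  rewrite (bigD1 (Ordinal (gN : (g < N.+1)%N))) //= ifT; last exact/asboolP.
  rewrite big_cons lerDl.
  by apply: sumr_ge0 => i _; case: ifP => // _; rewrite mulr_ge0.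
rewrite exchange_big /= mulrA [a w * _]mulrC -mulrA mulr_natl.
rewrite -[X in _ *+ X](card_ord N.+1) -sumr_const.
apply: ler_sum => g _; rewrite -big_mkcond -mulr_sumr ler_wpM2l //.
Qed.

End Gluing.

(** * Borel probability measures on a compact metric space *)

Section Borel.
Context {R : realType} {X : pmetricType R}.
Implicit Types (A U : set X) (F : X -> R).

Lemma open_borel U : open U -> measurable (U : set (borel X)).
Proof. by move=> oU; apply: sub_sigma_algebra. Qed.

Lemma closed_borel A : closed A -> measurable (A : set (borel X)).
Proof.
by move=> cA; rewrite -[A]setCK; apply: measurableC; apply: open_borel; exact: closed_openC.
Qed.

Lemma continuous_borel F : continuous F ->
  measurable_fun [set: borel X] (F : borel X -> R).
Proof.
move=> /continuousP cF; apply: (measurability _ (measurable_realfun.RGenOpens.measurableE R)).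
move=> _ [_ [a [b ->]] <-]; rewrite setTI; apply: open_borel.
by apply: cF; exact: interval_open.
Qed.

Lemma continuous_preimage_borel (T : X -> X) (A : set (borel X)) :
  continuous T -> measurable A -> measurable (T @^-1` A : set (borel X)).
Proof.
move=> /continuousP cT mA.
suff sub : (measurable : set (set (borel X))) `<=`
  [set A | measurable (T @^-1` A : set (borel X))] by exact: sub.
apply: smallest_sub => [|U oU]; last by apply: open_borel; apply: cT.
split => [|B mB|F mF] /=.
- by rewrite preimage_set0; exact: measurable0.
- by rewrite setTD preimage_setC; exact: measurableC.
- by rewrite preimage_bigcup; exact: bigcupT_measurable.
Qed.

Lemma bounded_continuous_integrable (mu : {finite_measure set (borel X) -> \bar R})
    F (B : R) : continuous F -> (forall x, `|F x| <= B) ->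
  mu.-integrable [set: borel X] (EFin \o F).
Proof.
move=> cF FB; apply: measurable_bounded_integrable => //.
- by rewrite ltey_eq fin_num_measure.
- exact: continuous_borel.
- by exists B; split; rewrite ?num_real // => M BM x _; apply: le_trans (ltW BM).
Qed.

End Borel.

Section Regularity.
Context {R : realType} {X : pmetricType R}.
Variable nu : {finite_measure set (borel X) -> \bar R}.
Implicit Types (A U K : set X).
Local Open Scope ereal_scope.

Definition regular A := forall e : R, (0 < e)%R -> exists K U,
  [/\ closed K, open U, K `<=` A, A `<=` U & nu (U `\` K) < e%:E].

Lemma near_lte (u : (\bar R)^nat) (l e : \bar R) :
  u @ \oo --> l -> l < e -> \forall n \near \oo, u n < e.
Proof.
move=> ul le; have : nbhs l [set y | y < e].
  by apply: open_nbhs_nbhs; split; [exact: open_ereal_lt_ereal|].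
exact: ul.
Qed.

(** An open set is exhausted by the closed sets of points at distance at least
    [1 / n] from its complement. *)
Lemma open_regular U : open U -> regular U.
Proof.
move=> oU e e0.
pose F n := [set x | forall y, (mdist x y < n.+1%:R^-1)%R -> U y].
have cF n : closed (F n).
  rewrite -openC openE => x /= /existsNP[y /not_implyP[xy nUy]].
  apply/metricType_numDomainType.nbhs_mdistP.
  exists (n.+1%:R^-1 - mdist x y)%R => /=; first by rewrite subr_gt0.
  move=> z /= xz; apply/existsNP; exists y; apply/not_implyP; split => //.
  apply: le_lt_trans (metric_triangle z x y) _.
  by rewrite (metric_sym z x) -ltrBrDr.
have UF : \bigcap_n (U `\` F n) = set0.
  apply/seteqP; split => // x Ux.
  have Ux0 : U x by have [] := Ux 0%N I.
  have : \forall y \near x, U y by move: oU; rewrite openE; exact.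
  move=> /metricType_numDomainType.nbhs_mdistP[/= d d0 Hd].
  have [] := Ux (Num.truncn d^-1) I; move=> _; apply => y xy; apply: Hd => /=.
  apply: lt_trans xy _; rewrite -[ltRHS]invrK ltf_pV2 ?posrE ?invr_gt0 //.
  exact: truncnS_gt.
have mU := open_borel oU; have mF n := closed_borel (cF n).
have := @nonincreasing_cvg_mu _ (borel X) R nu (fun n => U `\` F n).
rewrite UF measure0 => cvg.
have {}cvg : nu (U `\` F n) @[n --> \oo] --> 0.
  apply: cvg => //.
  - by rewrite ltey_eq fin_num_measure //; exact: measurableD.
  - by move=> n; exact: measurableD.
  - apply/nonincreasing_seqP => n; apply/subsetPset => x [Ux nFx]; split => //.
    apply: contra_not nFx => Fx y xy; apply: Fx; apply: lt_le_trans xy _.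
    by rewrite lef_pV2 ?posrE // ler_nat.
have [n _ Hn] : \forall n \near \oo, nu (U `\` F n) < e%:E.
  by apply: near_lte cvg _; rewrite lte_fin.
exists (F n), U; split => //; last exact: (Hn n (leqnn _)).
by move=> x Fx; apply: Fx; rewrite mdistxx invr_gt0.
Qed.

(** Regular sets form a sigma-algebra; for a countable union the union of the
    inner closed sets is replaced by a finite one, by continuity of the
    measure along decreasing sequences. *)
Lemma borel_regular A : measurable (A : set (borel X)) -> regular A.
Proof.
move=> mA; suff sub : (measurable : set (set (borel X))) `<=` regular by exact: sub.
apply: smallest_sub; last by move=> U; exact: open_regular.
split.
- move=> e e0; exists set0, set0; split => //; [exact: closed0|exact: open0|].
  by rewrite set0D measure0 lte_fin.
- move=> B rB e /rB[K [U [cK oU KB BU KU]]]; exists (~` U), (~` K).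
  rewrite setTD; split; [exact: open_closedC|exact: closed_openC|exact: subsetC|exact: subsetC|].
  by rewrite setDE setCK setIC -setDE.
- move=> B rB e e0.
  have e20 : (0 < e / 2)%R by rewrite divr_gt0.
  have ch i : exists KU : set X * set X, [/\ closed KU.1, open KU.2,
      KU.1 `<=` B i, B i `<=` KU.2 &
      nu (KU.2 `\` KU.1) < (e / 2 / (2 ^ i.+1)%:R)%:E].
    have [|K [U ?]] := rB i (e / 2 / (2 ^ i.+1)%:R)%R; last by exists (K, U).
    by rewrite divr_gt0 // ltr0n expn_gt0.
  have [KU HKU] := choice ch.
  pose K i := (KU i).1; pose U i := (KU i).2.
  have cK i : closed (K i) by have [] := HKU i.
  have oU i : open (U i) by have [] := HKU i.
  have KB i : K i `<=` B i by have [] := HKU i.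
  have BU i : B i `<=` U i by have [] := HKU i.
  have mK i := closed_borel (cK i); have mU i := open_borel (oU i).
  have oUU : open (\bigcup_i U i) by apply: bigcup_open.
  have mUU := open_borel oUU.
  have mKK : measurable (\bigcup_i K i : set (borel X)) by exact: bigcupT_measurable.
  have small : nu (\bigcup_i U i `\` \bigcup_i K i) < e%:E.
    apply: (@le_lt_trans _ _ (e / 2)%:E); last by rewrite lte_fin; lra.
    apply: le_trans (epsilon_trick0 xpredT (ltW e20)).
    have sub := @measure_sigma_subadditive _ _ _ nu (\bigcup_i U i `\` \bigcup_i K i)
      (fun i => U i `\` K i).
    apply: le_trans (sub _ _ _) _.
    + by move=> i; exact: measurableD.
    + exact: measurableD.
    + move=> x [[i _ Uix] nK]; exists i => //; split => //.
      by apply: contra_not nK => Kix; exists i.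
    + apply: lee_nneseries => // i _; have [_ _ _ _ KUi] := HKU i.
      exact: ltW KUi.
  pose F n : set X := \bigcup_(i < n) K i.
  have cF n : closed (F n).
    by apply: closed_bigcup; [exact: finite_II|move=> i _; exact: cK].
  have mF n := closed_borel (cF n).
  have cvg : nu (\bigcup_i U i `\` F n) @[n --> \oo] -->
             nu (\bigcup_i U i `\` \bigcup_i K i).
    have -> : \bigcup_i U i `\` \bigcup_i K i = \bigcap_n (\bigcup_i U i `\` F n).
      apply/seteqP; split => [x [Ux nK] n _|x Hx].
        by split => //; apply: contra_not nK => -[i _ Ki]; exists i.
      split; first by have [] := Hx 0%N I.
      by move=> [i _ Kix]; have [_] := Hx i.+1 I; apply; exists i => /=.
    apply: nonincreasing_cvg_mu.
    + by rewrite ltey_eq fin_num_measure //; exact: measurableD.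
    + by move=> n; exact: measurableD.
    + by apply: bigcapT_measurable => n; exact: measurableD.
    + apply/nonincreasing_seqP => n; apply/subsetPset => x [Ux nFx]; split => //.
      by apply: contra_not nFx => -[i /= ltin Kix]; exists i => //=; exact: ltnW.
  have [n _ Hn] : \forall n \near \oo, nu (\bigcup_i U i `\` F n) < e%:E.
    exact: near_lte cvg small.
  exists (F n), (\bigcup_i U i); split => //.
  + by move=> x [i _ Kix]; exists i => //; exact: KB.
  + by move=> x [i _ Bix]; exists i => //; exact: BU.
  + exact: (Hn n (leqnn _)).
Qed.

Lemma inner_closed A (e : R) : measurable (A : set (borel X)) -> (0 < e)%R ->
  exists K, [/\ closed K, K `<=` A & nu (A `\` K) < e%:E].
Proof.
move=> mA /(borel_regular mA)[K [U [cK oU KA AU KU]]].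
exists K; split => //; apply: le_lt_trans KU; apply: le_measure.
- by rewrite inE; apply: measurableD => //; exact: closed_borel.
- by rewrite inE; apply: measurableD; [exact: open_borel|exact: closed_borel].
- exact: setSD.
Qed.

End Regularity.

Section Support.
Context {R : realType} {X : pmetricType R}.
Implicit Types (x y : X).

(** A set of positive measure contains a closed, hence compact, set of positive
    measure, which cannot be covered by finitely many null open sets. *)
Lemma meets_support (nu : probability (borel X) R) (A : set X) :
    compact [set: X] -> measurable (A : set (borel X)) -> (0 < nu A)%E ->
  exists x, A x /\ measure_support nu x.
Proof.
move=> cX mA nuA.
have nuAfin : nu A \is a fin_num by rewrite fin_num_measure.
have e0 : 0 < fine (nu A) by rewrite fine_gt0 // nuA ltey_eq nuAfin.
have [K [cK KA nuAK]] := inner_closed nu mA e0.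
have mK := closed_borel cK.
have nuK : (0 < nu K)%E.
  rewrite lt0e measure_ge0 andbT; apply/eqP => nuK0.
  move: nuAK; rewrite fineK // measureD // ?ltey_eq ?nuAfin //.
  have AK : (nu (A `&` K) = 0)%E by rewrite (setIidr KA); exact: nuK0.
  by rewrite [X in (_ - X < _)%E]AK sube0 ltxx.
apply: contrapT => none.
have cpK : compact K by apply: subclosed_compact cK cX _.
have ex x : exists U : set X, K x -> [/\ open U, U x & nu U = 0%E].
  have [Kx|nKx] := pselect (K x); last by exists set0 => /nKx.
  have : ~ measure_support nu x.
    by apply: contra_not none => sx; exists x; split => //; exact: KA.
  rewrite /measure_support /= => /existsNP[U /not_implyP[oU /not_implyP[Ux U0]]].
  exists U => _; split => //; apply/eqP; rewrite eq_le measure_ge0 andbT.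
  by rewrite leNgt; apply/negP.
have [V HV] := choice ex.
move: cpK; rewrite compact_cover => /(_ X K V)[||D DK KD].
- by move=> x /HV[].
- by move=> x Kx; exists x => //; have [] := HV x Kx.
move: nuK; apply/negP; rewrite -leNgt.
have oV x : x \in D -> open (V x) /\ nu (V x) = 0%E.
  by move=> /DK; rewrite inE => /HV[].
apply: le_trans (_ : nu (\bigcup_(x in [set` D]) V x) <= _)%E.
  apply: le_measure => //; rewrite inE //.
  by apply: open_borel; apply: bigcup_open => x /oV[].
have sub := @content_sub_fsum _ _ _ nu X [set` D]
  (\bigcup_(x in [set` D]) V x) V.
apply: le_trans (sub _ _ _ _) _ => //.
- by move=> x /oV[oVx _]; exact: open_borel.
- by apply: open_borel; apply: bigcup_open => x /oV[].
- by rewrite fsbig1 // => x /oV[].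
Qed.

Lemma invariant_support (nu : probability (borel X) R) (T : X -> X) :
    continuous T -> invariant_measures T nu ->
  forall x, measure_support nu x -> measure_support nu (T x).
Proof.
move=> /continuousP cT inv x sx U oU UTx.
by rewrite -(inv U (open_borel oU)); apply: sx => //; exact: cT.
Qed.

(** Around a point, the closed sets not containing it can be avoided; by
    compactness the radius can be chosen uniformly. *)
Lemma closed_separation (J : finType) (K : J -> set X) :
    compact [set: X] -> (forall j, closed (K j)) ->
    (forall i j x, K i x -> K j x -> i = j) ->
  exists2 r : R, 0 < r & forall x y z i j,
    mdist x y < r -> mdist x z < r -> K i y -> K j z -> i = j.
Proof.
move=> /compact_near_coveringP cX cK dK.
have near0 : \forall r \near 0^'+, [set: X] `<=` [set x | forall y z i j,
    mdist x y < r -> mdist x z < r -> K i y -> K j z -> i = j].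
  apply: cX => x _.
  have : \forall y \near x, forall j, ~ K j x -> ~ K j y.
    have fr : forall j : J, \forall y \near x, ~ K j x -> ~ K j y.
      move=> j; have [Kx|nKx] := pselect (K j x); first by apply: nearW.
      have : open (~` K j) by exact: closed_openC.
      by rewrite openE => /(_ x nKx); apply: filterS => y.
    exact: (@filter_forall X J (fun j y => ~ K j x -> ~ K j y) (nbhs x) _ fr).
  move=> /metricType_numDomainType.nbhs_mdistP[/= d d0 Hd].
  exists ([set x' | mdist x x' < d / 2], [set r : R | 0 < r < d / 2]) => /=.
    split.
      by apply/metricType_numDomainType.nbhs_mdistP; exists (d / 2) => //=; lra.
    by near=> r; apply/andP; split; near: r;
      [exact: nbhs_right_gt | apply: nbhs_right_lt; lra].
  move=> [x' r] [/= xx' /andP[r0 rd]] y z i j x'y x'z Ky Kz.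
  have Kx k t : mdist x' t < r -> K k t -> K k x.
    move=> x't Kt; apply: contrapT => nKx; apply: (Hd t _ k nKx Kt) => /=.
    by have := metric_triangle x x' t; lra.
  exact: dK (Kx _ _ x'y Ky) (Kx _ _ x'z Kz).
have [r [r0 Hr]] : exists r : R, 0 < r /\ [set: X] `<=` [set x | forall y z i j,
    mdist x y < r -> mdist x z < r -> K i y -> K j z -> i = j].
  near (0 : R)^'+ => r; exists r; split; first by near: r; exact: nbhs_right_gt.
  by near: r.
by exists r => // x y z i j; apply: Hr.
Unshelve. all: by end_near. Qed.

End Support.

(** * Finite codes and their laws *)

Section Codes.
Context d {E : measurableType d} {R : realType}.
Variable mu : {finite_measure set E -> \bar R}.
Implicit Types W : finType.
Local Open Scope ereal_scope.

Lemma integral_weighted_indic W (P : pred W) (a : W -> R) (B : W -> set E) :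
  (forall w, P w -> measurable (B w)) ->
  mu.-integrable [set: E] (fun x => (\sum_(w | P w) a w * \1_(B w) x)%R%:E) /\
  \int[mu]_x (\sum_(w | P w) a w * \1_(B w) x)%R%:E =
  (\sum_(w | P w) a w * fine (mu (B w)))%R%:E.
Proof.
move=> mB; pose B' w := if P w then B w else set0.
have mB' w : measurable (B' w) by rewrite /B'; case: ifP => // /mB.
pose f w x := (a w)%:E * (\1_(B' w) x)%:E : \bar R.
have intf w : mu.-integrable [set: E] (f w).
  by apply: integrableZl => //; exact: integrable_indic.
have -> : (fun x => (\sum_(w | P w) a w * \1_(B w) x)%R%:E) =
    (fun x => \sum_(w <- index_enum W | P w) f w x).
  apply/funext => x; rewrite sumEFin; congr (_%:E); apply: eq_bigr => w Pw.
  by rewrite /B' Pw.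
split; first exact: integrable_sum.
rewrite integral_sum // -sumEFin; apply: eq_bigr => w Pw.
rewrite integralZl //; last exact: integrable_indic.
rewrite integral_indic // setIT /B' Pw EFinM fineK //.
by apply: fin_num_measure; exact: mB.
Qed.

(** The pointwise bound on the total weight is integrated over [A]. *)
Lemma weighted_cover W (P : pred W) (a : W -> R) (B : W -> set E) (A : set E) (M : R) :
    (forall w, P w -> measurable (B w)) -> measurable A ->
    (forall w, P w -> B w `<=` A) ->
    (forall x, \sum_(w | P w && `[< B w x >]) a w <= M)%R ->
  (\sum_(w | P w) a w * fine (mu (B w)) <= M * fine (mu A))%R.
Proof.
move=> mB mA BA aM; rewrite -lee_fin.
have [intB <-] := integral_weighted_indic a mB.
have mA' (w : unit) : xpredT w -> measurable A by [].
have [intA eqA] := integral_weighted_indic (fun=> M) mA'.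
move: eqA; rewrite (big_pred1 tt); last by case.
move=> <-; apply: le_integral => // x _; rewrite lee_fin.
rewrite (big_pred1 tt); last by case.
have sumE : (\sum_(w | P w) a w * \1_(B w) x =
   \sum_(w | P w && `[< B w x >]) a w)%R.
  rewrite big_mkcondr; apply: eq_bigr => w _; rewrite indicE.
  by case: asboolP => Bx; [rewrite mem_set ?mulr1|rewrite memNset ?mulr0].
have [Ax|nAx] := pselect (A x).
  by rewrite sumE indicE mem_set // mulr1.
rewrite big1 => [|w Pw]; first by rewrite indicE memNset // mulr0.
by rewrite indicE memNset ?mulr0 // => /(BA _ Pw).
Qed.

Definition measurable_code W (c : E -> W) := forall w, measurable (c @^-1` [set w]).

Definition law W (c : E -> W) (w : W) : R := fine (mu (c @^-1` [set w])).

Lemma law_ge0 W (c : E -> W) w : (0 <= law c w)%R.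
Proof. exact: fine_ge0. Qed.

Lemma integral_code W (c : E -> W) (g : W -> R) : measurable_code c ->
  mu.-integrable [set: E] (fun x => (g (c x))%:E) /\
  \int[mu]_x (g (c x))%:E = (\sum_w law c w * g w)%R%:E.
Proof.
move=> mc; have [] := @integral_weighted_indic W xpredT g (fun w => c @^-1` [set w]).
  by move=> w _; exact: mc.
have gE x : (\sum_w g w * \1_(c @^-1` [set w]) x)%R = g (c x).
  rewrite (bigD1 (c x)) //= indicE mem_set // mulr1 big1 ?addr0 // => w wc.
  by rewrite indicE memNset ?mulr0 //= => cw; rewrite -cw eqxx in wc.
under eq_fun do rewrite gE.
move=> -> ->; split => //; congr (_%:E).
by apply: eq_bigr => w _; rewrite mulrC.
Qed.

Lemma measurable_code_pred W (c : E -> W) (B : pred W) : measurable_code c ->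
  measurable [set x | B (c x)].
Proof.
move=> mc.
have -> : [set x | B (c x)] = \bigcup_(w in [set` B]) (c @^-1` [set w]).
  apply/seteqP; split => [x Bcx|x [w Bw /= cw]]; first by exists (c x).
  by rewrite /= cw.
by apply: fin_bigcup_measurable => // w _; exact: mc.
Qed.

Lemma law_pred W (c : E -> W) (B : pred W) : measurable_code c ->
  fine (mu [set x | B (c x)]) = (\sum_(w | B w) law c w)%R.
Proof.
move=> mc; have [_] := integral_code (fun w => (B w)%:R%R) mc.
have -> : (fun x => (B (c x))%:R%:E) = (fun x => (\1_[set x | B (c x)] x)%:E :> \bar R).
  apply/funext => x; rewrite indicE.
  case BE: (B (c x)); first by rewrite mem_set.
  by rewrite memNset //= BE.
rewrite integral_indic //; last exact: measurable_code_pred.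
rewrite setIT => ->; rewrite /= [RHS]big_mkcond /=.
by apply: eq_bigr => w _; case: (B w); rewrite ?mulr1 ?mulr0.
Qed.

Definition entropy W (p : W -> R) : R := (- \sum_w p w * ln (p w))%R.

(** Each outcome is at most as likely as the merged one containing it, so its
    self-information is at least as large. *)
Lemma entropy_merge (V W : finType) (f : W -> V) (p : W -> R) : (forall w, 0 <= p w)%R ->
  (entropy (fun v => \sum_(w | f w == v) p w) <= entropy p)%R.
Proof.
move=> p0; rewrite lerN2 (partition_big f xpredT) //=; apply: ler_sum => v _.
rewrite mulr_suml; apply: ler_sum => w /eqP fw.
have := p0 w; rewrite le_eqVlt => /predU1P[<-|pw]; first by rewrite !mul0r.
rewrite ler_pM2l //.
have le : (p w <= \sum_(w | f w == v) p w)%R.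
  by rewrite (bigD1 w) ?fw //= lerDl sumr_ge0.
by rewrite ler_ln ?posrE //; exact: lt_le_trans le.
Qed.

End Codes.

Section CodeConstructions.
Context d {E : measurableType d} {R : realType}.
Implicit Types (I S : finType).

Lemma measurable_code_ffun I S (c : I -> E -> S) :
  (forall i, measurable_code (c i)) ->
  measurable_code (fun x => [ffun i => c i x]).
Proof.
move=> mc w.
have -> : (fun x => [ffun i => c i x]) @^-1` [set w] =
    \bigcap_(i in [set: I]) (c i @^-1` [set w i]).
  apply/seteqP; split => [x <- i _|x Hx]; first by rewrite /= ffunE.
  by apply/ffunP => i; rewrite ffunE; exact: Hx.
apply: fin_bigcap_measurable; first exact: finite_finset.
by move=> i _; exact: mc.
Qed.

Lemma measurable_code_pair I S (c : E -> I) (c' : E -> S) :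
  measurable_code c -> measurable_code c' ->
  measurable_code (fun x => (c x, c' x)).
Proof.
move=> mc mc' [i s].
have -> : (fun x => (c x, c' x)) @^-1` [set (i, s)] =
    (c @^-1` [set i]) `&` (c' @^-1` [set s]).
  by apply/seteqP; split => [x [<- <-]|x [/= -> ->]].
exact: measurableI.
Qed.

Lemma measurable_code_bool (A : set E) :
  measurable A -> measurable_code (fun x => `[< A x >]).
Proof.
move=> mA [].
  rewrite (_ : _ @^-1` _ = A) //.
  by apply/seteqP; split => x /asboolP.
rewrite (_ : _ @^-1` _ = ~` A); first exact: measurableC.
apply/seteqP; split => x /=; first by move=> e Ax; rewrite asboolT in e.
by move=> nAx; rewrite asboolF.
Qed.

End CodeConstructions.

Section BlockCodes.
Context {R : realType} {X : pmetricType R}.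
Variables (nu : probability (borel X) R) (T : X -> X).
Implicit Types (S J : finType) (F : X -> R).

Lemma sum_law S (c : borel X -> S) : measurable_code c ->
  \sum_s law nu c s = 1.
Proof.
move=> mc; rewrite -(law_pred nu xpredT mc).
have -> : [set x : borel X | xpredT (c x)] = setT by apply/seteqP; split.
exact: (congr1 fine (@probability_setT _ _ _ nu)).
Qed.

Lemma fine_law_approx S (c : borel X -> S) F (G : S -> R) (B eta : R) :
    measurable_code c -> continuous F -> (forall x, `|F x| <= B) ->
    (forall x, `|F x - G (c x)| <= eta) ->
  `|\sum_s law nu c s * G s - fine (\int[nu]_x (F x)%:E)| <= eta.
Proof.
move=> mc cF FB FG.
have intF := bounded_continuous_integrable nu cF FB.
have [intG eqG] := integral_code nu G mc.
have inte : nu.-integrable [set: borel X] (EFin \o cst eta : borel X -> \bar R).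
  exact: finite_measure_integrable_cst.
have inte_eta : (\int[nu]_x (EFin \o cst eta : borel X -> \bar R) x = eta%:E)%E.
  apply: (eq_trans (integral_cst nu (@measurableT _ (borel X)) eta%:E)).
  exact: (eq_trans (congr1 (mule eta%:E) (@probability_setT _ _ _ nu)) (mule1 _)).
have finF : (\int[nu]_x (F x)%:E)%E \is a fin_num by apply: integrable_fin_num.
have le1 : (\int[nu]_x (F x)%:E <= \int[nu]_x (G (c x))%:E + eta%:E)%E.
  rewrite -inte_eta -integralD //; apply: le_integral => //.
    exact: integrableD.
  by move=> x _; rewrite /= -EFinD lee_fin; have := FG x; rewrite ler_norml; lra.
have le2 : (\int[nu]_x (G (c x))%:E <= \int[nu]_x (F x)%:E + eta%:E)%E.
  rewrite -inte_eta -integralD //; apply: le_integral => //.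
    exact: integrableD.
  by move=> x _; rewrite /= -EFinD lee_fin; have := FG x; rewrite ler_norml; lra.
move: le1 le2; rewrite eqG -(fineK finF) -!EFinD !lee_fin /= => le1 le2.
by rewrite ler_norml; lra.
Qed.

Definition block S (sigma : X -> S) n (x : borel X) : {ffun 'I_n -> S} :=
  [ffun i : 'I_n => sigma (iter i T x)].

Hypothesis cT : continuous T.

Lemma continuous_iter n : continuous (iter n T).
Proof.
elim: n => [|n IH] x; first exact: cvg_id.
by apply: continuous_comp; [exact: IH|exact: cT].
Qed.

Lemma measurable_code_iter S (sigma : X -> S) n :
  measurable_code (sigma : borel X -> S) ->
  measurable_code ((fun x => sigma (iter n T x)) : borel X -> S).
Proof.
move=> mc s; apply: (continuous_preimage_borel (@continuous_iter n) (mc s)).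
Qed.

Lemma measurable_block S (sigma : X -> S) n :
  measurable_code (sigma : borel X -> S) -> measurable_code (block sigma n).
Proof.
by move=> mc; apply: measurable_code_ffun => i; exact: measurable_code_iter.
Qed.

Hypothesis inv : invariant_measures T nu.

Lemma invariant_iter (A : set (borel X)) n :
  measurable A -> nu (iter n T @^-1` A) = nu A.
Proof.
move=> mA; elim: n => [|n IH] //; rewrite -IH.
rewrite -(inv (continuous_preimage_borel (@continuous_iter n) mA)).
by congr (nu _); apply/seteqP; split => x /=; rewrite -iterS iterSr.
Qed.

(** By invariance, the law of a symbol does not depend on the time at which it
    is observed. *)
Lemma block_marginal S (sigma : X -> S) n (i : 'I_n) (g : S -> R) :
  measurable_code (sigma : borel X -> S) ->
  \sum_w law nu (block sigma n) w * g (w i) =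
  \sum_s law nu (sigma : borel X -> S) s * g s.
Proof.
move=> mc.
have [_ e1] := integral_code nu (fun w : {ffun _} => g (w i)) (measurable_block mc).
have [_ e2] := integral_code nu g (measurable_code_iter i mc).
have : (\sum_w law nu (block sigma n) w * g (w i))%:E =
  (\sum_s law nu ((fun x => sigma (iter i T x)) : borel X -> S) s * g s)%:E.
  by rewrite -e1 -e2; apply: eq_integral => x _; rewrite ffunE.
move=> [->]; apply: eq_bigr => s _; congr (fine _ * _).
exact: (invariant_iter _ (mc s)).
Qed.

(** Up to the oscillation on the cells, [F] is a function of the symbol, and a
    representative point has the symbols prescribed by its block, so only the
    one-time law matters. *)
Lemma block_mean S (sigma : X -> S) n (x : {ffun 'I_n -> S} -> X) F (B eta : R) :
    measurable_code (sigma : borel X -> S) ->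
    continuous F -> (forall y, `|F y| <= B) ->
    (forall y z, sigma y = sigma z -> `|F y - F z| <= eta) ->
    (forall w, law nu (block sigma n) w != 0 -> block sigma n (x w) = w) ->
  `|\sum_w law nu (block sigma n) w * birkhoff_sum T F n (x w)
    - n%:R * fine (\int[nu]_y (F y)%:E)| <= n%:R * (2 * eta).
Proof.
move=> mc cF FB osc rep.
have [G GE] : exists G : S -> R, forall y, `|F y - G (sigma y)| <= eta.
  have ex s : exists g, forall y, sigma y = s -> `|F y - g| <= eta.
    have [[y ys]|none] := pselect (exists y, sigma y = s).
      by exists (F y) => z zs; apply: osc; rewrite ys.
    by exists 0 => y ys; case: none; exists y.
  by have [G HG] := choice ex; exists G => y; exact: HG.
have appr := fine_law_approx mc cF FB GE.
set I := fine _ in appr *.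
set L := \sum_s _ in appr.
have sumG : \sum_w law nu (block sigma n) w * \sum_(i < n) G (w i) = n%:R * L.
  under eq_bigr do rewrite mulr_sumr.
  rewrite exchange_big /=; under eq_bigr do rewrite block_marginal //.
  by rewrite sumr_const card_ord mulr_natl.
have diff : `|\sum_w law nu (block sigma n) w * birkhoff_sum T F n (x w) - n%:R * L|
    <= n%:R * eta.
  rewrite -sumG -sumrB; apply: le_trans (ler_norm_sum _ _ _) _.
  have mb : measurable_code (block sigma n) by exact: measurable_block.
  rewrite -[leRHS]mul1r -[X in _ <= X * _](sum_law mb) mulr_suml.
  apply: ler_sum => w _; rewrite -mulrBr normrM ger0_norm ?law_ge0 //.
  have [->|/rep xw] := eqVneq (law nu (block sigma n) w) 0; first by rewrite !mul0r.
  rewrite ler_wpM2l ?law_ge0 // /birkhoff_sum -sumrB.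
  apply: le_trans (ler_norm_sum _ _ _) _.
  rewrite mulr_natl -[X in _ *+ X](card_ord n) -sumr_const.
  by apply: ler_sum => i _; rewrite -{2}xw ffunE.
have LI : `|n%:R * L - n%:R * I| <= n%:R * eta.
  by rewrite -mulrBr normrM ger0_norm // ler_wpM2l.
apply: le_trans (ler_distD (n%:R * L) _ _) _; lra.
Qed.

(** The block code refines the itinerary with respect to [P]. *)
Lemma join_entropy_le S (sigma : X -> S) n k (P : 'I_k -> set (borel X)) (j : S -> 'I_k) :
    measurable_code (sigma : borel X -> S) -> measurable_partition P ->
    (forall x, P (j (sigma x)) x) ->
  join_entropy T nu P n <= entropy (law nu (block sigma n)).
Proof.
move=> mc [mP /trivIsetP tP _] Pj.
have PE x i : P i x -> i = j (sigma x).
  move=> Pix; apply/eqP; apply: contrapT => /negP ne.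
  have := tP _ _ I I ne; rewrite -subset0 => /(_ x); apply; split => //.
pose f (w : {ffun 'I_n -> S}) : {ffun 'I_n -> 'I_k} := [ffun i => j (w i)].
apply: le_trans (entropy_merge f (law_ge0 nu (block sigma n))).
rewrite /join_entropy /entropy lerN2 le_eqVlt; apply/orP; left; apply/eqP.
apply: eq_bigr => v _ /=.
rewrite -(law_pred nu (fun w => f w == v) (measurable_block mc)).
rewrite (_ : join_cell T P v = [set x | f (block sigma n x) == v]) //.
apply/seteqP; split => x /=.
  by move=> Hx; apply/eqP/ffunP => i; rewrite !ffunE; rewrite -(PE _ _ (Hx i)).
by move=> /eqP <- i; rewrite !ffunE; exact: Pj.
Qed.

Lemma block_representatives S (sigma : X -> S) n : compact [set: X] ->
    measurable_code (sigma : borel X -> S) ->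
  exists x : {ffun 'I_n -> S} -> X, (forall w, measure_support nu (x w)) /\
    (forall w, law nu (block sigma n) w != 0 -> block sigma n (x w) = w).
Proof.
move=> cX mc; have [x0 [_ sx0]] := @meets_support _ _ nu [set: X] cX measurableT
  (eq_rect _ (fun e => (0 < e)%E) lte01 _ (esym (@probability_setT _ _ _ nu))).
have ex w : exists y, measure_support nu y /\
    (law nu (block sigma n) w != 0 -> block sigma n y = w).
  have [_|ne] := eqVneq (law nu (block sigma n) w) 0; first by exists x0.
  have mw := measurable_block mc w.
  have [|y [yw sy]] := @meets_support _ _ nu _ cX mw; last by exists y.
  rewrite measure_gt0; apply: contra_neq ne => nu0.
  by rewrite /law nu0.
have [x Hx] := choice ex; exists x; split => w; first by have [] := Hx w.
by have [_] := Hx w.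
Qed.

End BlockCodes.

Section SymbolCodes.
Context {R : realType} {X : pmetricType R}.
Variable nu : probability (borel X) R.

(** Recording membership in the balls around a finite net makes the cells
    small. *)
Lemma fine_code k (P : 'I_k -> set (borel X)) (r : R) : compact [set: X] ->
    measurable_partition P -> 0 < r ->
  exists (J : finType) (c : borel X -> J) (j : J -> 'I_k),
  [/\ measurable_code c, forall x, P (j (c x)) x &
      forall x y : X, c x = c y -> mdist x y < r].
Proof.
move=> cX [mP /trivIsetP tP covP] r0.
have ex (x : borel X) : exists i, P i x.
  have : (\bigcup_i P i) x by rewrite covP.
  by case=> i _ Pi; exists i.
have [idx idxP] := choice ex.
have midx : measurable_code idx.
  move=> i; rewrite (_ : _ @^-1` _ = P i) //.
  apply/seteqP; split => x /=; first by move=> <-.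
  move=> Pix; apply/eqP; apply: contrapT => /negP ne.
  by have := tP _ _ I I ne; rewrite -subset0 => /(_ x); apply; split.
have r20 : 0 < r / 2 by lra.
have [s net] := compact_net cX r20.
pose ball_code (x : borel X) := [ffun i : 'I_(size s) =>
  `[< mdist (nth point s i) x < r / 2 >]].
exists ('I_k * {ffun 'I_(size s) -> bool})%type, (fun x => (idx x, ball_code x)), fst.
split => //.
- apply: measurable_code_pair => //; apply: measurable_code_ffun => i.
  by apply: measurable_code_bool; apply: open_borel; exact: open_mdist_ball.
- move=> x y [_ /ffunP same].
  have [c cs cx] := net x.
  have is_ : (index c s < size s)%N by rewrite index_mem.
  have := same (Ordinal is_); rewrite !ffunE /= nth_index //.
  rewrite asboolT // => /esym/asboolP cy.
  by have := metric_triangle x c y; rewrite (metric_sym x c); lra.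
Qed.

(** Each symbol receives a flag telling whether the point lies in a closed
    subset of its cell that exhausts the cell up to a small measure. *)
Lemma flagged_code (J : finType) (c : borel X -> J) (theta : R) :
    measurable_code c -> 0 < theta ->
  exists (K : J -> set X) (sigma : borel X -> J * bool),
  [/\ measurable_code sigma, forall j, closed (K j),
      forall i j x, K i x -> K j x -> i = j,
      forall x, (sigma x).1 = c x /\ ((sigma x).2 -> K (c x) x) &
      \sum_j law nu sigma (j, false) <= theta].
Proof.
move=> mc theta0.
have t0 : 0 < theta / #|J|.+1%:R by rewrite divr_gt0.
have ex j : exists K : set X, [/\ closed K, K `<=` c @^-1` [set j] &
    (nu (c @^-1` [set j] `\` K) < (theta / #|J|.+1%:R)%:E)%E].
  exact: inner_closed (mc j) t0.
have [K HK] := choice ex.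
have cK j : closed (K j) by have [] := HK j.
have Kc j : K j `<=` c @^-1` [set j] by have [] := HK j.
pose sigma (x : borel X) := (c x, `[< K (c x) x >]).
have fib_false j : sigma @^-1` [set (j, false)] = c @^-1` [set j] `\` K j.
  apply/seteqP; split => x /=.
    by move=> [<- e]; split => // Kx; rewrite asboolT in e.
  by move=> [<- nKx]; rewrite /sigma asboolF.
exists K, sigma; split => //.
- move=> [j [|]]; last first.
    by rewrite fib_false; apply: measurableD => //; exact: closed_borel.
  rewrite (_ : _ @^-1` _ = K j); first exact: closed_borel.
  apply/seteqP; split => x /=; first by move=> [<-] /asboolP.
  by move=> Kx; rewrite /sigma (Kc _ _ Kx) asboolT.
- by move=> i j x /Kc /= <- /Kc.
- by move=> x; split => //= /asboolP.
- apply: le_trans (_ : \sum_(j : J) theta / #|J|.+1%:R <= _).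
    apply: ler_sum => j _; rewrite /law fib_false -lee_fin fineK.
      by have [_ _ /ltW] := HK j.
    by rewrite fin_num_measure //; apply: measurableD => //; exact: closed_borel.
  rewrite sumr_const -[leLHS]mulr_natl mulrA ler_pdivrMr // mulrC.
  by rewrite ler_wpM2l ?(ltW theta0) // ler_nat.
Qed.

Lemma sum_flagged (J : finType) (f : J * bool -> R) :
  \sum_s f s = \sum_j (f (j, true) + f (j, false)).
Proof.
transitivity (\sum_(s : J * bool) f (s.1, s.2)); first by apply: eq_bigr => -[].
rewrite -(pair_bigA _ (fun j i => f (j, i))) /=.
by apply: eq_bigr => j _; rewrite big_bool.
Qed.

Definition symbol_weight (J : finType) (b : R) (s : J * bool) : R :=
  if s.2 then 1 else b.

(** A point is close to at most one of the separated closed sets, so at each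
    time at most one symbol of full weight is possible; the symbols
    outside the closed sets only contribute a small total weight. *)
Lemma compatible_symbol_weight (J : finType) (K : J -> set X) (r b : R) z :
    0 <= b ->
    (forall x y z i j, mdist x y < r -> mdist x z < r -> K i y -> K j z -> i = j) ->
  \sum_(s : J * bool | `[< s.2 -> exists2 y, K s.1 y & mdist z y < r >])
    symbol_weight b s <= 1 + #|J|%:R * b.
Proof.
move=> b0 sep; rewrite big_mkcond.
rewrite sum_flagged big_split /= lerD //; last first.
  rewrite mulr_natl -sumr_const; apply: ler_sum => j _.
  by rewrite /symbol_weight /=; case: ifP.
have [[j0 [y0 Ky0 zy0]]|none] := pselect (exists j, exists2 y, K j y & mdist z y < r).
  rewrite (bigD1 j0) //= big1 ?addr0; first by case: ifP.
  move=> j ne; case: asboolP => // /(_ isT) [y Ky zy].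
  by rewrite (sep _ _ _ _ _ zy zy0 Ky Ky0) eqxx in ne.
rewrite big1 // => j _; case: asboolP => // /(_ isT) ex.
by case: none; exists j.
Qed.

Lemma compatible_block_weight (J : finType) (K : J -> set X) (r b : R) T
    (sigma : X -> J * bool) n (x : {ffun 'I_n -> J * bool} -> X) z :
    0 <= b ->
    (forall x y z i j, mdist x y < r -> mdist x z < r -> K i y -> K j z -> i = j) ->
    (forall y, (sigma y).2 -> K (sigma y).1 y) ->
  \sum_(w | `[< forall i, (i < n)%N -> mdist (iter i T (x w)) (iter i T z) < r >])
    (if block T sigma n (x w) == w then \prod_i symbol_weight b (w i) else 0)
  <= (1 + #|J|%:R * b) ^+ n.
Proof.
move=> b0 sep sK.
pose ok (i : 'I_n) (s : J * bool) :=
  `[< s.2 -> exists2 y, K s.1 y & mdist (iter i T z) y < r >].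
have q0 s : 0 <= symbol_weight b s :> R by rewrite /symbol_weight; case: ifP.
apply: le_trans (_ : \sum_(w : {ffun 'I_n -> J * bool})
    \prod_i (if ok i (w i) then symbol_weight b (w i) else 0) <= _).
  rewrite big_mkcond; apply: ler_sum => w _.
  have nn : 0 <= \prod_i (if ok i (w i) then symbol_weight b (w i) else 0).
    by apply: prodr_ge0 => i _; case: ifP.
  case: asboolP => // near; case: eqP => // xw.
  apply: ler_prod => i _; rewrite q0 /=.
  rewrite ifT //; apply/asboolP => wi; exists (iter i T (x w)).
    by move: wi; rewrite -{1 2}xw ffunE; exact: sK.
  by rewrite metric_sym; exact: near.
rewrite -(bigA_distr_bigA (fun i s => if ok i s then symbol_weight b s else 0)) /=.
rewrite -[X in _ ^+ X](card_ord n) -prodr_const; apply: ler_prod => i _.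
rewrite sumr_ge0 /=; last by move=> s _; case: ifP.
by rewrite -big_mkcond; exact: compatible_symbol_weight.
Qed.

End SymbolCodes.

(** * Lower bounds for the reference measure *)

Section LowerBound.
Context {R : realType} {X : pmetricType R}.
Variables (T : X -> X) (m : {finite_measure set (borel X) -> \bar R}).
Hypotheses (cX : compact [set: X]) (cT : continuous T).
Implicit Types (x y z : X).

Lemma bowen_ball_borel n x (e : R) :
  measurable (bowen_ball T n x e : set (borel X)).
Proof.
have -> : bowen_ball T n x e = \bigcap_(i in [set: 'I_n])
    (iter i T @^-1` [set z | mdist (iter i T x) z < e]).
  apply/seteqP; split => z Hz; first by move=> i _; exact: Hz.
  by move=> i lin; exact: (Hz (Ordinal lin) I).
apply: (@fin_bigcap_measurable _ (borel X)) => [|i _]; first exact: finite_finset.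
apply: (@continuous_preimage_borel _ _ (iter i T)).
  exact: continuous_iter.
by apply: open_borel; exact: open_mdist_ball.
Qed.

(** The Bowen balls of the points shadowing the good sequences of segments all
    lie in [E] and cover no point with too large a weight; the error terms in
    the exponent account for the shadowing distance and for the gaps. *)
Lemma weighted_orbits (W : finType) (x : W -> X) (a : W -> R) (xi : X -> R)
    (n N l k : nat) (M C eps delta eta B : R) (E : set X) (good : pred (k.-tuple W)) :
    (0 < n)%N -> (0 < k)%N -> (k * (n + N) <= l)%N ->
    (forall w, 0 <= a w) -> 0 < C -> 0 < delta ->
    (forall y, `|xi y| <= B) ->
    (forall y z, mdist y z < eps -> `|xi y - xi z| <= eta) ->
    (forall y n, C * expR (- birkhoff_sum T xi n y) <= fine (m (bowen_ball T n y eps))) ->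
    (forall u, pseudo_orbit T delta u ->
       exists y, forall n, mdist (iter n T y) (u n) < eps) ->
    (forall w w', chain_upto T delta N (iter n T (x w)) (x w')) ->
    (forall z, \sum_(w | `[< forall i, (i < n)%N ->
        mdist (iter i T (x w)) (iter i T z) < eps + eps >]) a w <= M) ->
    measurable (E : set (borel X)) ->
    (forall s : k.-tuple W, good s -> forall z,
       traces T n N (eps + eps) (map x s) z -> E z) ->
  C * expR (- ((k * n)%:R * eta + (l - k * n)%:R * B)) *
    \sum_(s : k.-tuple W | good s)
      \prod_(w <- s) (a w * expR (- birkhoff_sum T xi n (x w)))
  <= (N.+1%:R * M) ^+ k * fine (m E).
Proof.
move=> n0 k0 kl a0 C0 delta0 xiB osc mball shad ch compat mE goodE.
have ex (s : k.-tuple W) : exists y, traces T n N eps (map x s) y.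
  case: s => -[|w s] sk; first by exfalso; move: k0; rewrite -(eqP sk).
  have [|||u [ups _ ucon]] := @pseudo_orbit_concatenation _ _ T (range x) n N delta
     n0 delta0 _ (map x s) (x w).
  - by move=> _ _ [v _ <-] [v' _ <-].
  - by exists w.
  - by move=> _ /mapP[v _ ->]; exists v.
  have [y Hy] := shad u ups; exists y.
  exact: shadow_traces ucon Hy.
have [y Hy] := choice ex.
have sz (s : k.-tuple W) : size (map x s) = k by rewrite size_map size_tuple.
have cover := @weighted_cover _ (borel X) R m _ good
  (fun s => \prod_(w <- s) a w) (fun s => bowen_ball T l (y s) eps) E
  ((N.+1%:R * M) ^+ k).
apply: le_trans (cover _ mE _ _).
- rewrite mulr_sumr; apply: ler_sum => s gs.
  rewrite big_split /= mulrCA ler_wpM2l ?prodr_ge0 //.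
  apply: le_trans (mball (y s) l); rewrite -mulrA ler_wpM2l ?(ltW C0) //.
  rewrite -expR_sum -expRD ler_expR sumrN -opprD lerN2.
  have := birkhoff_sum_traces xiB osc (Hy s) (l := l); rewrite sz => /(_ kl).
  by rewrite big_map ler_norml => /andP[_]; lra.
- by move=> s _; exact: bowen_ball_borel.
- move=> s gs z yz; apply: (goodE s gs).
  by apply: traces_bowen (Hy s) _ yz; rewrite sz.
- move=> z; apply: le_trans (trace_multiplicity N a0 compat k z).
  rewrite [leRHS]big_mkcond [leLHS]big_mkcond /=; apply: ler_sum => s _.
  have pa0 : 0 <= \prod_(w <- s) a w by apply: prodr_ge0.
  case: andP => [[_ /asboolP yz]|_]; last by case: ifP.
  rewrite ifT //; apply/asboolP.
  by apply: traces_bowen (Hy s) _ yz; rewrite sz.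
Qed.

End LowerBound.

Section Chains.
Context {R : realType} {X : pmetricType R}.
Variable T : X -> X.

Lemma chain_trans (e : R) x y z : chain T e x y -> chain T e y z -> chain T e x z.
Proof.
move=> [k [u [k1 u0 uk uch]]] [l [v [l1 v0 vl vch]]].
exists (k + l)%N, (fun i => if (i <= k)%N then u i else v (i - k)%N); split.
- by rewrite (leq_trans k1) // leq_addr.
- by [].
- by rewrite leqNgt -[ltnLHS]addn0 ltn_add2l l1 /= addKn.
- move=> i ikl; have [ik|ki] := ltnP i k; first by rewrite (ltnW ik); exact: uch.
  rewrite subSn //; move: ki ikl; rewrite leq_eqVlt => /predU1P[<-|ki] ikl.
    by rewrite leqnn subnn uk -v0; apply: vch.
  rewrite leqNgt ki /=; apply: vch.
  by rewrite ltn_subLR ?(ltnW ki).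
Qed.

Lemma chain_class_transitive Y : chain_recurrent_class T Y ->
  forall x y : X, Y x -> Y y -> forall e : R, 0 < e -> chain T e x y.
Proof.
move=> [p _ ->] x y [_ px] [_ py] e e0.
by have [_ xp] := px e e0; have [py' _] := py e e0; exact: chain_trans xp py'.
Qed.

End Chains.

Section Entropy.
Context {R : realType} {X : pmetricType R}.

(** When the sequence of averages does not converge, the limit operator
    returns 0, which is still dominated by the nonnegative averages. *)
Lemma partition_entropy_attained (T : X -> X) (nu : probability (borel X) R) k
    (P : 'I_k -> set (borel X)) (eta : R) n0 :
    continuous T -> (forall i, measurable (P i)) -> 0 < eta ->
  exists n, [/\ (n0 <= n)%N, (0 < n)%N &
    n%:R * (partition_entropy T nu P - eta) <= join_entropy T nu P n].
Proof.
move=> cT mP eta0; pose u n : R := n%:R^-1 * join_entropy T nu P n.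
have H0 n : 0 <= join_entropy T nu P n.
  rewrite oppr_ge0; apply: sumr_le0 => w _ /=.
  have mw : measurable (join_cell T P w).
    rewrite (_ : join_cell T P w = \bigcap_(i in [set: 'I_n]) (iter i T @^-1` P (w i))).
      apply: (@fin_bigcap_measurable _ (borel X)) => [|i _].
        exact: finite_finset.
      apply: (@continuous_preimage_borel _ _ (iter i T)) (mP (w i)).
      exact: continuous_iter.
    by apply/seteqP; split => z Hz i; [move=> _|]; exact: Hz.
  rewrite mulr_ge0_le0 ?fine_ge0 // ln_le0 // -lee_fin fineK.
    exact: probability_le1.
  exact: fin_num_measure.
have [cu|ncu] := pselect (cvgn u).
  have /cvgrPdist_lt/(_ _ eta0)[n1 _ Hn] : u n @[n --> \oo] --> limn u by [].
  exists (maxn n0 (maxn n1 1)); rewrite leq_maxl !leq_max leqnn !orbT; split => //.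
  have := Hn (maxn n0 (maxn n1 1)); rewrite /= !leq_max leqnn orbT => /(_ isT).
  set n := maxn _ _; have n_gt0 : 0 < n%:R :> R.
    by rewrite ltr0n !leq_max !orbT.
  rewrite /u -/(partition_entropy T nu P) ltr_norml => /andP[_ lt].
  rewrite -ler_pdivlMl //; lra.
exists (maxn n0 1); rewrite leq_maxl leq_max orbT; split => //.
have -> : partition_entropy T nu P = 0.
  exact: dvgP ncu.
by apply: le_trans (H0 _); rewrite sub0r mulrN oppr_le0 mulr_ge0 // ltW.
Qed.

End Entropy.
(** * The exponential lower bound *)

Section Main.
Context {R : realType} {X : pmetricType R}.
Variables (T : X -> X) (m : {finite_measure set (borel X) -> \bar R}).
Hypotheses (cX : compact [set: X]) (cT : continuous T).
Hypothesis shad : shadowing_property T.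
Variables (Phi xi : X -> R).
Hypotheses (cPhi : continuous Phi) (xiV : Vminus T m xi).
Variable nu : probability (borel X) R.
Hypothesis inv : invariant_measures T nu.

Lemma birkhoff_level_borel n (c : R) :
  measurable ([set x | c < n%:R^-1 * birkhoff_sum T Phi n x] : set (borel X)).
Proof.
have mS : measurable_fun [set: borel X]
    ((fun x => n%:R^-1 * birkhoff_sum T Phi n x) : borel X -> R).
  apply: measurable_realfun.measurable_funM; first exact: measurable_cst.
  apply: measurable_sum => i; apply: continuous_borel => x.
  by apply: continuous_comp; [exact: continuous_iter|exact: cPhi].
rewrite (_ : mkset _ = [set: borel X] `&`
    (fun x => n%:R^-1 * birkhoff_sum T Phi n x) @^-1` `]c, +oo[%classic).
  by apply: mS.
by apply/seteqP; split => x /=; rewrite in_itv /= andbT // => -[].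
Qed.

Lemma iterate_in_support n x : measure_support nu x ->
  measure_support nu (iter n T x).
Proof. by move=> sx; elim: n => // n IH; rewrite iterS; exact: (invariant_support cT inv). Qed.

(** All errors are collected in multiples of [eta]: in [F] they come from the
    oscillation on the cells, the deviation of the independent blocks and the
    shadowing distance; in [D] also from the choice of [n], the rare symbols
    and the two multiplicity factors. *)
Lemma exponential_lower_bound (Y : set X) k0 (P : 'I_k0 -> set (borel X)) (eta B : R) :
    chain_recurrent_class T Y -> supported_on nu Y -> measurable_partition P ->
    0 < eta -> (forall x, `|Phi x| <= B) -> (forall x, `|xi x| <= B) ->
  let F := fine (\int[nu]_x (Phi x)%:E) in
  let D := partition_entropy T nu P - fine (\int[nu]_x (xi x)%:E) in
  exists n N K C, [/\ 0 < C, (0 < n)%N, N%:R <= eta * n%:R &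
    forall k l c, (0 < k)%N -> (K <= k)%N -> (k * (n + N) <= l)%N ->
      c * l%:R < (k * n)%:R * (F - 4 * eta) - (l - k * n)%:R * B ->
      C * expR ((k * n)%:R * (D - 8 * eta) - (l - k * n)%:R * B) <=
      fine (m [set x | c < l%:R^-1 * birkhoff_sum T Phi l x])].
Proof.
move=> classY suppY partP eta0 PhiB xiB F D.
have [cxi small_xi] := xiV.
have [rP rP0 HrP] := compact_uniform_continuity cX cPhi eta0.
have [rx rx0 Hrx] := compact_uniform_continuity cX cxi eta0.
have oscP y z : mdist y z < rP -> `|Phi y - Phi z| <= eta.
  by move=> /HrP; rewrite -ball_normE => /ltW.
have oscx y z : mdist y z < rx -> `|xi y - xi z| <= eta.
  by move=> /Hrx; rewrite -ball_normE => /ltW.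
pose r0 := Num.min rP rx.
have r00 : 0 < r0 by rewrite lt_min rP0.
have [J [c [j [mc Pc diam]]]] := fine_code cX partP r00.
(* Symbols outside the closed sets get weight b, so small that all of them
   together contribute at most eta to the multiplicity at each time. *)
pose b : R := eta / #|J|.+1%:R.
have b0 : 0 < b by rewrite divr_gt0.
have Jb : #|J|%:R * b <= eta.
  rewrite /b mulrA ler_pdivrMr // mulrC ler_wpM2l ?(ltW eta0) //.
  by rewrite ler_nat.
(* They have probability at most theta, so small that replacing their weight 1 by b
   lowers the mean logarithm of the weight by at most eta per time step. *)
pose theta : R := eta / (1 + `|ln b|).
have lnb1 : 0 < 1 + `|ln b| by rewrite ltr_pwDl.
have theta0 : 0 < theta by rewrite divr_gt0.
have [K [sigma [msig cK dK sigE rare]]] := flagged_code nu mc theta0.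
have [r1 r10 sep] := closed_separation cX cK dK.
have e00 : 0 < Num.min r0 r1 / 2 by rewrite divr_gt0 // lt_min r00.
have [eps [/andP[eps0 epsr] [C C0 mball]]] := small_xi _ e00.
have eps2 : eps + eps < Num.min r0 r1 by lra.
have epsP : eps + eps < rP by apply: lt_le_trans eps2 _; rewrite /r0 !ge_min lexx.
have epsx : eps + eps < rx.
  by apply: lt_le_trans eps2 _; rewrite /r0 !ge_min lexx orbT.
have eps1 : eps + eps < r1.
  by apply: lt_le_trans eps2 _; rewrite /r0 !ge_min lexx orbT.
have [delta delta0 Hshad] := shad eps0.
have [N HN] := @uniform_chain_length _ _ T (measure_support nu) delta cX cT delta0
  (fun x y sx sy => chain_class_transitive classY (suppY x sx) (suppY y sy)).
(* Blocks long enough to make the gaps, and the factor N.+1 lost for each of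
   them in the decoding, negligible. *)
pose n0 := maxn (Num.truncn (N%:R / eta)).+1 (Num.truncn (ln N.+1%:R / eta)).+1.
have [mP _ _] := partP.
have [n [n0n n_gt0 Hn]] := @partition_entropy_attained _ _ T nu _ P eta n0 cT mP eta0.
have nN : N%:R <= eta * n%:R.
  rewrite mulrC -ler_pdivrMr //; apply: le_trans (ltW (truncnS_gt _)) _.
  by rewrite ler_nat (leq_trans _ n0n) // leq_maxl.
have nlnN : ln N.+1%:R <= n%:R * eta.
  rewrite -ler_pdivrMr //; apply: le_trans (ltW (truncnS_gt _)) _.
  by rewrite ler_nat (leq_trans _ n0n) // leq_maxr.
have [x [sx xrep]] := block_representatives nu cT n cX msig.
pose p := law nu (block T sigma n).
have p0 w : 0 <= p w := law_ge0 nu (block T sigma n) w.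
have p1 : \sum_w p w = 1 by apply: sum_law; exact: measurable_block.
pose a w : R := if block T sigma n (x w) == w then
  \prod_i symbol_weight b (w i) else 0.
have q0 (s : J * bool) : 0 < symbol_weight b s by rewrite /symbol_weight; case: ifP.
have a0 w : 0 <= a w by rewrite /a; case: ifP => // _; apply: prodr_ge0 => i _; exact: ltW.
pose phi w := birkhoff_sum T Phi n (x w).
pose S w := birkhoff_sum T xi n (x w).
pose lq (w : {ffun 'I_n -> J * bool}) : R := \sum_i ln (symbol_weight b (w i)).
(* The logarithm of the weight of a block divided by its probability; its mean
   is the entropy of the blocks minus the mean of the cost. *)
pose lam w := - S w + lq w - ln (p w).
have pa w : p w * expR (lam w) <= a w * expR (- S w).
  have [->|pw] := eqVneq (p w) 0; first by rewrite mul0r mulr_ge0 ?expR_ge0.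
  have pw0 : 0 < p w by rewrite lt_neqAle eq_sym pw p0.
  have eK : expR (ln (p w)) = p w by rewrite lnK ?posrE.
  have <- : expR (lq w) = a w.
    rewrite /a xrep // eqxx expR_sum; apply: eq_bigr => i _.
    by rewrite lnK ?posrE.
  rewrite /lam !expRD [expR (- ln _)]expRN eK le_eqVlt; apply/orP; left; apply/eqP.
  by field.
have cellP y z : sigma y = sigma z -> mdist y z < r0.
  move=> yz; apply: diam; have [<- _] := sigE y; have [<- _] := sigE z.
  by rewrite yz.
have meanphi : n%:R * (F - 2 * eta) <= \sum_w p w * phi w.
  have := @block_mean _ _ nu T cT inv _ sigma n x Phi B eta msig cPhi PhiB _ xrep.
  rewrite ler_norml => -/(_ _)/andP[|lo _].
    by move=> y z /cellP yz; apply: oscP; apply: lt_le_trans yz _; rewrite ge_min lexx.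
  rewrite -/F in lo; rewrite /p /phi; lra.
set I := fine (\int[nu]_x (xi x)%:E) in D *.
have meanS : \sum_w p w * S w <= n%:R * (I + 2 * eta).
  have := @block_mean _ _ nu T cT inv _ sigma n x xi B eta msig cxi xiB _ xrep.
  rewrite ler_norml => -/(_ _)/andP[|_ hi].
    move=> y z /cellP yz; apply: oscx; apply: lt_le_trans yz _.
    by rewrite ge_min lexx orbT.
  rewrite -/I in hi; rewrite /p /S; lra.
have meanlq : - (n%:R * eta) <= \sum_w p w * lq w.
  rewrite /lq; under eq_bigr do rewrite mulr_sumr.
  rewrite exchange_big /=.
  under eq_bigr do rewrite (block_marginal cT inv _ (fun s => ln (symbol_weight b s)) msig).
  rewrite sumr_const card_ord -[leRHS]mulr_natl -mulrN ler_wpM2l //.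
  rewrite sum_flagged; under eq_bigr do rewrite /symbol_weight /= ln1 mulr0 add0r.
  rewrite -mulr_suml.
  have L0 : 0 <= \sum_j law nu sigma (j, false).
    by apply: sumr_ge0 => i _; exact: law_ge0.
  have tb : theta * `|ln b| <= eta.
    by rewrite /theta mulrAC ler_pdivrMr // ler_wpM2l ?(ltW eta0) // lerDr.
  apply: le_trans (_ : - (theta * `|ln b|) <= _); first by rewrite lerN2.
  have := ler_wpM2r (normr_ge0 (ln b)) rare.
  have := ler_wpM2l L0 (ler_norm (- ln b)); rewrite normrN; lra.
have meanlam : n%:R * (D - 4 * eta) <= \sum_w p w * lam w.
  have cellE y : P (j (sigma y).1) y by have [-> _] := sigE y.
  have H := le_trans Hn (@join_entropy_le _ _ nu T cT _ sigma n _ P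
    (fun s => j s.1) msig partP cellE).
  rewrite /entropy -/p in H.
  have -> : \sum_w p w * lam w = - \sum_w p w * S w + \sum_w p w * lq w
     - \sum_w p w * ln (p w).
    rewrite -!sumrN -!big_split /=; apply: eq_bigr => w _.
    by rewrite /lam; ring.
  rewrite /D; lra.
have neta0 : 0 < n%:R * eta by rewrite mulr_gt0 // ltr0n.
have [k1 Hk1] := iid_weight phi p0 p1 neta0 pa.
exists n, N, k1, (C / 2); split; rewrite ?divr_gt0 // => k l c0 k_gt0 k1k kl level.
have l_gt0 : 0 < l%:R :> R.
  by rewrite ltr0n (leq_trans _ kl) // muln_gt0 k_gt0 addn_gt0 n_gt0.
set E := [set _ | _].
have mE : measurable (E : set (borel X)) by exact: birkhoff_level_borel.
have mE0 : 0 <= fine (m E) by exact: fine_ge0.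
have := @weighted_orbits _ _ T m cT _ x a xi n N l k ((1 + #|J|%:R * b) ^+ n)
  C eps delta eta B E (fun s => k%:R * (\sum_w p w * phi w - n%:R * eta) <=
     \sum_(w <- s) phi w) n_gt0 k_gt0 kl a0 C0 delta0 xiB.
have oscx' y z : mdist y z < eps -> `|xi y - xi z| <= eta.
  by move=> yz; apply: oscx; lra.
have mball' y i : C * expR (- birkhoff_sum T xi i y) <= fine (m (bowen_ball T i y eps)).
  rewrite -lee_fin fineK; first exact: mball.
  by rewrite fin_num_measure //; exact: bowen_ball_borel.
have chn w w' : chain_upto T delta N (iter n T (x w)) (x w').
  by apply: HN; [exact: iterate_in_support|exact: sx].
move=> /(_ oscx' mball' Hshad chn).
have sep' (x0 y z : X) i i' : mdist x0 y < eps + eps -> mdist x0 z < eps + eps ->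
    K i y -> K i' z -> i = i'.
  by move=> xy xz; apply: sep; [apply: lt_trans xy _|apply: lt_trans xz _].
have sK y : (sigma y).2 -> K (sigma y).1 y by have [-> ] := sigE y.
move=> /(_ (fun z => @compatible_block_weight _ _ J K _ b T sigma n x z (ltW b0) sep' sK) mE).
have goodE (s : k.-tuple {ffun 'I_n -> J * bool}) :
    k%:R * (\sum_w p w * phi w - n%:R * eta) <= \sum_(w <- s) phi w ->
    forall z, traces T n N (eps + eps) (map x s) z -> E z.
  move=> good z tr; rewrite /E /= ltr_pdivlMl //.
  have oscP' (y y' : X) : mdist y y' < eps + eps -> `|Phi y - Phi y'| <= eta.
    by move=> yy; apply: oscP; exact: lt_trans yy _.
  have := birkhoff_sum_traces PhiB oscP' tr (l := l).
  rewrite size_map size_tuple big_map => /(_ kl).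
  rewrite -[\sum_(_ <- _) _]/(\sum_(w <- s) phi w) ler_norml => /andP[lo _].
  have := ler_wpM2l (ler0n R k) meanphi.
  by move: good level lo; rewrite natrM; lra.
move=> /(_ goodE) upper.
have lower := Hk1 k k1k.
have mult : (N.+1%:R * (1 + #|J|%:R * b) ^+ n) ^+ k <= expR (k%:R * (2 * (n%:R * eta))).
  rewrite expRM_natl lerXn2r ?nnegrE ?expR_ge0 //.
    by rewrite mulr_ge0 // exprn_ge0 // addr_ge0 // mulr_ge0 ?(ltW b0).
  rewrite [2 * _]mulr_natl mulr2n expRD ler_pM //.
  - by rewrite exprn_ge0 // addr_ge0 // mulr_ge0 ?(ltW b0).
  - by rewrite -[leLHS]lnK ?posrE // ler_expR.
  - rewrite expRM_natl lerXn2r ?nnegrE ?expR_ge0 //.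
      by rewrite addr_ge0 // mulr_ge0 ?(ltW b0).
    by apply: le_trans (expR_ge1Dx _); rewrite lerD2l.
have {}upper := le_trans upper (ler_wpM2r mE0 mult).
rewrite -(ler_pM2l (expR_gt0 (k%:R * (2 * (n%:R * eta))))).
apply: le_trans upper.
set t := (l - k * n)%:R * B.
have eC : 0 <= C * expR (- ((k * n)%:R * eta + t)) by rewrite mulr_ge0 ?expR_ge0 ?(ltW C0).
apply: le_trans (ler_wpM2l eC lower).
rewrite mulrCA -[C / 2]mulrC -!mulrA -(mulrCA C) ler_pM2l // [leRHS]mulrCA ler_pM2l ?invr_gt0 //.
rewrite -!expRD ler_expR natrM.
have := ler_wpM2l (ler0n R k) meanlam; lra.
Qed.

End Main.
Section Rates.
Context {R : realType}.

Lemma limn_einf_ge (u : (\bar R)^nat) (a : \bar R) :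
  (\forall n \near \oo, (a <= u n)%E) -> (a <= limn_einf u)%E.
Proof.
move=> [n0 _ Hn]; rewrite limn_einf_lim; apply: lime_ge; first exact: is_cvg_einfs.
exists n0 => // n /= n0n; apply: le_ereal_inf_tmp => _ [k /= nk <-].
by apply: Hn; rewrite /= (leq_trans n0n).
Qed.

(** One [eta] pays for the gaps, the other for the incomplete last block. *)
Lemma block_filling (n N l : nat) (eta : R) : (0 < n)%N -> 0 < eta ->
    N%:R <= eta * n%:R -> (n + N)%:R <= eta * l%:R ->
  (l - l %/ (n + N) * n)%:R <= 2 * eta * l%:R.
Proof.
move=> n0 eta0 nN nNl; set k := (l %/ (n + N))%N.
have nN0 : (0 < n + N)%N by rewrite addn_gt0 n0.
have kl : (k * n <= l)%N.
  by apply: leq_trans (leq_divM l (n + N)); rewrite leq_mul2l leq_addr orbT.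
have lk : (l < k * (n + N) + (n + N))%N by have := ltn_ceil l nN0; rewrite mulSn addnC.
have le1 : (l - k * n <= k * N + (n + N))%N.
  by rewrite leq_subLR addnA -mulnDr ltnW.
have kN : (k * N)%:R <= eta * l%:R :> R.
  rewrite natrM; apply: le_trans (ler_wpM2l _ nN) _; first exact: ler0n.
  by rewrite mulrCA ler_wpM2l ?(ltW eta0) // -natrM ler_nat.
by have := le1; rewrite -(ler_nat R) natrD; lra.
Qed.

End Rates.

Lemma continuous_integral_fin_num (R : realType) (X : pmetricType R)
    (mu : {finite_measure set (borel X) -> \bar R}) (F : X -> R) :
  compact [set: X] -> continuous F -> (\int[mu]_x (F x)%:E)%E \is a fin_num.
Proof.
move=> cX cF; have [B FB] := compact_continuous_bounded cX cF.
by apply: integrable_fin_num => //; exact: bounded_continuous_integrable FB.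
Qed.

Lemma lower_rate_partition (R : realType) (X : pmetricType R) (T : X -> X)
    (m : {finite_measure set (borel X) -> \bar R}) (Phi xi : X -> R) (c : R)
    (nu : probability (borel X) R) (Y : set X) k (P : 'I_k -> set (borel X)) :
  compact [set: X] -> continuous T -> shadowing_property T ->
  continuous Phi -> Vminus T m xi -> invariant_measures T nu ->
  (c%:E < \int[nu]_x (Phi x)%:E)%E ->
  chain_recurrent_class T Y -> supported_on nu Y -> measurable_partition P ->
  ((partition_entropy T nu P)%:E - \int[nu]_x (xi x)%:E <=
   lower_rate T m Phi `]c, +oo[)%E.
Proof.
move=> cX cT shad cPhi xiV inv cPhi_nu classY suppY partP.
have [cxi _] := xiV.
have [B1 PhiB1] := compact_continuous_bounded cX cPhi.
have [B2 xiB2] := compact_continuous_bounded cX cxi.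
pose B := Num.max B1 B2.
have PhiB x : `|Phi x| <= B by rewrite le_max PhiB1.
have xiB x : `|xi x| <= B by rewrite le_max xiB2 orbT.
have B0 : 0 <= B by apply: le_trans (PhiB point).
have finPhi := continuous_integral_fin_num nu cX cPhi.
have finxi := continuous_integral_fin_num nu cX cxi.
rewrite -(fineK finxi) -EFinB; move: cPhi_nu; rewrite -(fineK finPhi) lte_fin.
set F := fine _ => cF; set D := _ - _.
apply/lee_addgt0Pr => gamma gamma0.
rewrite -leeBlDr // -EFinB.
(* The constants absorb the errors 4 * eta or 8 * eta of the block bound and the
   proportion 2 * eta of the time not covered by blocks. *)
pose eta1 := gamma / (25 + 2 * `|D| + 2 * B).
pose eta2 := (F - c) / (21 + 2 * `|F| + 2 * B).
pose eta := Num.min 1 (Num.min eta1 eta2).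
have d1 : 0 < 25 + 2 * `|D| + 2 * B by have := normr_ge0 D; lra.
have d2 : 0 < 21 + 2 * `|F| + 2 * B by have := normr_ge0 F; lra.
have eta0 : 0 < eta by rewrite !lt_min ltr01 !divr_gt0 // subr_gt0.
have eta_1 : eta <= 1 by rewrite ge_min lexx.
have eta_g : eta * (25 + 2 * `|D| + 2 * B) <= gamma.
  by rewrite -ler_pdivlMr // !ge_min lexx !orbT.
have eta_F : eta * (21 + 2 * `|F| + 2 * B) <= F - c.
  by rewrite -ler_pdivlMr // !ge_min lexx !orbT.
have [n [N [K [C [C0 n0 nN bound]]]]] :=
  exponential_lower_bound cX cT shad cPhi xiV inv classY suppY partP eta0 PhiB xiB.
rewrite -/F -/D in bound.
apply: limn_einf_ge.
pose l0 := maxn ((K + 1) * (n + N))%N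
  (maxn (Num.truncn ((n + N)%:R / eta)).+1 (Num.truncn (- ln C / eta)).+1).
exists l0 => // l /= l0l.
have nN0 : (0 < n + N)%N by rewrite addn_gt0 n0.
have large (r : R) : ((Num.truncn (r / eta)).+1 <= l)%N -> r <= eta * l%:R.
  move=> rl; rewrite mulrC -ler_pdivrMr //; apply: le_trans (ltW (truncnS_gt _)) _.
  by rewrite ler_nat.
have lK : ((K + 1) * (n + N) <= l)%N by apply: leq_trans l0l; rewrite leq_maxl.
have lnN : (n + N)%:R <= eta * l%:R.
  by apply: large; apply: leq_trans l0l; rewrite !leq_max leqnn orbT.
have lC : - ln C <= eta * l%:R.
  by apply: large; apply: leq_trans l0l; rewrite !leq_max leqnn !orbT.
have l_gt0 : 0 < l%:R :> R.
  by rewrite ltr0n (leq_trans _ lK) // muln_gt0 addn1 nN0.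
pose q := (l %/ (n + N))%N.
have Kq : (K + 1 <= q)%N by rewrite leq_divRL.
have fill := block_filling n0 eta0 nN lnN; rewrite -/q in fill.
have qn : (q * n <= l)%N.
  by apply: leq_trans (leq_divM l (n + N)); rewrite leq_mul2l leq_addr orbT.
have qnE : (q * n)%:R = l%:R - (l - q * n)%:R :> R by rewrite natrB // subKr.
set t := (l - q * n)%:R in fill qnE *.
have t0 : 0 <= t by exact: ler0n.
have slack (G e : R) : 0 <= e -> e <= 8 ->
    l%:R * (G - e * eta - 2 * eta * (`|G| + 8 + B)) <=
    (q * n)%:R * (G - e * eta) - t * B.
  move=> e0 e8; rewrite qnE.
  have le : G - e * eta + B <= `|G| + 8 + B by have := ler_norm G; nra.
  have : t * (G - e * eta + B) <= 2 * eta * l%:R * (`|G| + 8 + B).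
    apply: le_trans (ler_wpM2l t0 le) _; apply: ler_wpM2r => //.
    by have := normr_ge0 G; lra.
  by lra.
have level : c * l%:R < (q * n)%:R * (F - 4 * eta) - t * B.
  apply: lt_le_trans (slack F 4 _ _); rewrite ?ler0n ?ler_nat //.
  rewrite mulrC ltr_pM2l //; nra.
have q0 : (0 < q)%N by apply: leq_trans Kq; rewrite addn1.
have := bound q l c q0 (leq_trans (leq_addr _ _) Kq) (leq_divM _ _) level.
rewrite -/t => low.
set E := [set _ | _] in low.
rewrite (_ : [set x | _] = E); last first.
  by apply/seteqP; split => x; rewrite /E /= in_itv /= andbT.
have exp_le : expR (l%:R * (D - gamma)) <= fine (m E).
  apply: le_trans low; rewrite -[C]lnK ?posrE // -expRD ler_expR.
  have := slack D 8 (ler0n _ _) (lexx _).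
  have : l%:R * (D - gamma) <= l%:R * (D - 8 * eta - 2 * eta * (`|D| + 8 + B) - eta).
    by rewrite ler_pM2l //; nra.
  lra.
have mE : measurable (E : set (borel X)) by exact: birkhoff_level_borel.
have mE0 : 0 < fine (m E) by apply: lt_le_trans exp_le; exact: expR_gt0.
have finE : m E \is a fin_num by exact: fin_num_measure.
rewrite -(fineK finE) lne_EFin // -EFinM lee_fin ler_pdivlMl //.
by rewrite -[leLHS]expRK ler_ln ?posrE ?expR_gt0.
Qed.

Local Open Scope ereal_scope.

Theorem theorem3p5 (R : realType) (X : pmetricType R) (T : X -> X)
    (m : {finite_measure set (borel X) -> \bar R}) :
  compact [set: X] -> continuous T ->
  shadowing_property T -> topological_entropy T < +oo ->
  forall (Phi : X -> R) (c : R) (xi : X -> R),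
    continuous Phi -> Vminus T m xi ->
    ereal_sup [set metric_entropy T nu - \int[nu]_x (xi x)%:E | nu in
        [set nu | [/\ invariant_measures T nu,
                      c%:E < \int[nu]_x (Phi x)%:E &
                      exists2 Y : set X, chain_recurrent_class T Y &
                        supported_on nu Y]]]
    <= lower_rate T m Phi `]c, +oo[.
Proof.
move=> cX cT shad _ Phi c xi cPhi xiV.
apply: ge_ereal_sup => _ [nu [inv cF [Y classY suppY]] <-].
have finxi := continuous_integral_fin_num nu cX (proj1 xiV).
rewrite leeBlDr //; apply: ge_ereal_sup => _ [k [P [partP ->]]].
by rewrite -leeBlDr //; exact: (lower_rate_partition cX cT shad cPhi xiV inv cF classY suppY partP).
Qed.
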